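(* Let $n$ and $\delta$ be positive integers with $2n/3<\delta\le 3n/4$, and write $\delta=(1-\beta)n$ (so $1/4\le\beta<1/3$, $p=3$). Then $k_r(n,\delta)\ge g_r(\beta)n^r$ for every positive integer $r$. Moreover, for $r\in\{3,4\}$, equality $k_r(n,\delta)=g_r(\beta)n^r$ holds if and only if $(n,\beta)$ is feasible, and in that case a graph $G$ of order $n$ with minimum degree $\delta$ satisfies $k_r(G)=g_r(\beta)n^r$ if and only if $G\in\mathcal{G}(n,\beta)$.
   Context: All graphs are finite and simple; $k_r(G)$ is the number of $r$-cliques of $G$, and $k_r(n,\delta)$ is the minimum of $k_r(G)$ over all graphs $G$ of order $n$ with minimum degree $\delta$. Throughout, $\delta=(1-\beta)n$ with $0<\beta<1$, and $p=\lceil \beta^{-1}\rceil-1$, so $1/(p+1)\le \beta<1/p$. For such $\beta$ and integers $r$, define $$g_r(\beta)=\binom{p-1}{r}\beta^{r}+\binom{p-1}{r-1}(1-(p-1)\beta)\beta^{r-1}+\frac12\binom{p-1}{r-2}(1-p\beta)(1-(p-1)\beta)\beta^{r-2},$$ where $\binom{x}{y}=0$ if $x<y$ or $y<0$. The family $\mathcal{G}(n,\beta)$ (defined only when $n$ and $(1-\beta)n$ are positive integers not both odd) consists of all graphs $G$ on vertex set $V$, $|V|=n$, admitting a partition $V=V_0\cup V_1\cup\dots\cup V_{p-1}$ with $|V_0|=(1-(p-1)\beta)n$ and $|V_i|=\beta n$ for $1\le i\le p-1$, such that: all edges between $V_i$ and $V_j$ are present for $0\le i<j\le p-1$; $V_i$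 is independent for $1\le i\le p-1$; and $G[V_0]$ is $(1-p\beta)n$-regular with minimum number of triangles among all $(1-p\beta)n$-regular graphs on $|V_0|$ vertices. The pair $(n,\beta)$ is feasible if $\mathcal{G}(n,\beta)$ is defined and $G[V_0]$ is triangle-free for $G\in\mathcal{G}(n,\beta)$. *)

(* Defs.v *)
From HB Require Import structures.
From mathcomp Require Import all_boot all_order all_algebra.
Set Implicit Arguments. Unset Strict Implicit. Unset Printing Implicit Defensive.
Import Order.TTheory GRing.Theory Num.Theory.

Definition sgraph (n : nat) := {set {set 'I_n}}.

Definition simple n (E : sgraph n) : bool := [forall e in E, #|e| == 2%N].

Definition adj n (E : sgraph n) (x y : 'I_n) : bool :=
  (x != y) && ([set x; y] \in E).

Definition deg n (E : sgraph n) (v : 'I_n) : nat := #|[set u | adj E v u]|.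

Definition mindeg n (E : sgraph n) (d : nat) : bool :=
  [exists v, deg E v == d] && [forall v, d <= deg E v].

Definition clique n (E : sgraph n) (S : {set 'I_n}) : bool :=
  [forall x in S, forall y in S, (x != y) ==> adj E x y].

Definition kr n (E : sgraph n) (r : nat) : nat :=
  #|[set S : {set 'I_n} | (#|S| == r) && clique E S]|.

(* k_r(n, delta) : minimum of k_r(G) over simple graphs of order n with minimum
   degree delta.  'C(n,r) is an upper bound for every k_r(G), so it serves as a
   neutral start value (the index set is nonempty whenever delta < n). *)
Definition krmin (n d r : nat) : nat :=
  \big[minn/'C(n, r)]_(E : sgraph n | simple E && mindeg E d) kr E r.

Local Open Scope ring_scope.

Definition binz (x y : int) : nat :=
  if (y < 0) || (x < y) then 0%N else 'C(`|x|%N, `|y|%N).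

Definition pbeta (b : rat) : int := Num.ceil (b^-1) - 1.
Definition pnat (b : rat) : nat := `|pbeta b|%N.

Definition g (r : nat) (b : rat) : rat :=
  let p := pbeta b in
  (binz (p - 1) r)%:R * b ^+ r
  + (binz (p - 1) (r%:Z - 1))%:R * (1 - (p - 1)%:~R * b) * b ^+ (r.-1)
  + 1 / 2 * (binz (p - 1) (r%:Z - 2))%:R * (1 - p%:~R * b)
      * (1 - (p - 1)%:~R * b) * b ^+ (r - 2)%N.

Definition tri_in n (E : sgraph n) (V0 : {set 'I_n}) : nat :=
  #|[set S : {set 'I_n} | (S \subset V0) && (#|S| == 3%N) && clique E S]|.

Definition family_defined (n : nat) (b : rat) : Prop :=
  (0 < n)%N /\ exists d : nat, (0 < d)%N /\ d%:R = (1 - b) * n%:R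
                               /\ ~~ (odd n && odd d).

Definition family_part (n : nat) (b : rat) (E : sgraph n)
    (V : 'I_(pnat b) -> {set 'I_n}) : Prop :=
  let p := pbeta b in
  (forall i j : 'I_(pnat b), i != j -> [disjoint V i & V j]) /\
  (forall x : 'I_n, exists i, x \in V i) /\
  (forall i : 'I_(pnat b), val i = 0%N ->
      (#|V i|)%:R = (1 - (p - 1)%:~R * b) * n%:R) /\
  (forall i : 'I_(pnat b), val i <> 0%N -> (#|V i|)%:R = b * n%:R) /\
  (forall i j : 'I_(pnat b), i != j ->
      forall x y, x \in V i -> y \in V j -> adj E x y) /\
  (forall i : 'I_(pnat b), val i <> 0%N ->
      forall x y, x \in V i -> y \in V i -> ~~ adj E x y) /\
  (forall i : 'I_(pnat b), val i = 0%N ->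
     (forall v, v \in V i ->
        (#|[set u in V i | adj E v u]|)%:R = (1 - p%:~R * b) * n%:R) /\
     (forall H : sgraph #|V i|, simple H ->
        (forall v, (deg H v)%:R = (1 - p%:~R * b) * n%:R) ->
        (tri_in E (V i) <= kr H 3)%N)).

Definition in_family (n : nat) (b : rat) (E : sgraph n) : Prop :=
  family_defined n b /\ simple E /\ exists V, @family_part n b E V.

Definition feasible (n : nat) (b : rat) : Prop :=
  family_defined n b /\
  forall E V, simple E -> @family_part n b E V ->
    forall i : 'I_(pnat b), val i = 0%N -> tri_in E (V i) = 0%N.

(* Main.v *)
(** Put q = beta n = n - d, so that 3q < n <= 4q.  Every edge has at least n - 2q, and
    every triangle at least n - 3q, common neighbours; in the extremal graphs these
    codegrees also never exceed 2q and q.  Truncating codegrees at these two values and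
    double counting (triangle, edge) and (4-clique, triangle) incidences bounds k_3 and
    k_4 below, up to an error term carried by the heavy triangles (codegree > q).

    A heavy triangle without heavy edges (codegree > 2q), or with at least two of them,
    is paid for by its own slack in the triangle count.  For a heavy edge ab, the
    triangles abc whose only heavy edge is ab are paid for by the slack of the 4-cliques
    abcx: if c and x are adjacent, c and x cannot both be badly underpaid, so the
    deficits form a fractional independent set in the common neighbourhood of ab, where
    independent sets have size at most q; what remains is paid for by ab itself.

    In the case of equality nothing is heavy, the graph is regular and K_5-free, and each
    4-clique contains two triangles with codegree exactly q, whose common neighbourhoods
    are independent sets joined to everything else: these are V_1 and V_2. *)
Require Import Defs.
From HB Require Import structures.
From mathcomp Require Import all_boot all_order all_algebra.
From mathcomp Require Import zify ring lra.
Set Implicit Arguments. Unset Strict Implicit. Unset Printing Implicit Defensive.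
Import Order.TTheory GRing.Theory Num.Theory.
Local Open Scope ring_scope.

(** * Codegrees and sums over ordered cliques *)

Section OrderedCliqueSums.

Variables (V : finType) (e : rel V).
Hypothesis es : symmetric e.

Definition cl3 a b c := [&& e a b, e a c & e b c].
Definition cl4 a b c d := cl3 a b c && [&& e a d, e b d & e c d].

(* codegr counts the common neighbours of r vertices.  Suffixes such as _213 name the
   permutation of the arguments. *)
Definition codeg1 a := (\sum_v e a v)%N.
Definition codeg2 a b := (\sum_v (e a v && e b v))%N.
Definition codeg3 a b c := (\sum_v [&& e a v, e b v & e c v])%N.
Definition codeg4 a b c d := (\sum_v [&& e a v, e b v, e c v & e d v])%N.

(* Sums over ordered cliques: a sum over r-cliques is counted r! times. *)
Definition S2 (F : V -> V -> int) := \sum_a \sum_b if e a b then F a b else 0.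
Definition S3 (F : V -> V -> V -> int) :=
  \sum_a \sum_b \sum_c if cl3 a b c then F a b c else 0.
Definition S4 (F : V -> V -> V -> V -> int) :=
  \sum_a \sum_b \sum_c \sum_d if cl4 a b c d then F a b c d else 0.

Lemma eq_S2 F G : (forall a b, e a b -> F a b = G a b) -> S2 F = S2 G.
Proof.
by move=> H; apply: eq_bigr => a _; apply: eq_bigr => b _; case: ifP => // /H.
Qed.

Lemma eq_S3 F G : (forall a b c, cl3 a b c -> F a b c = G a b c) -> S3 F = S3 G.
Proof.
move=> H; do 3! [apply: eq_bigr => ? _]; case: ifP => // /H; exact.
Qed.

Lemma eq_S4 F G :
  (forall a b c d, cl4 a b c d -> F a b c d = G a b c d) -> S4 F = S4 G.
Proof.
move=> H; do 4! [apply: eq_bigr => ? _]; case: ifP => // /H; exact.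
Qed.

Lemma le_S3 F G : (forall a b c, cl3 a b c -> F a b c <= G a b c) -> S3 F <= S3 G.
Proof. move=> H; do 3! [apply: ler_sum => ? _]; case: ifP => // /H; exact. Qed.

Lemma le_S4 F G :
  (forall a b c d, cl4 a b c d -> F a b c d <= G a b c d) -> S4 F <= S4 G.
Proof. move=> H; do 4! [apply: ler_sum => ? _]; case: ifP => // /H; exact. Qed.

Lemma S2D F G : S2 (fun a b => F a b + G a b) = S2 F + S2 G.
Proof.
rewrite /S2 -big_split; apply: eq_bigr => a _; rewrite -big_split.
by apply: eq_bigr => b _; case: ifP => //=; rewrite addr0.
Qed.

Lemma S3D F G : S3 (fun a b c => F a b c + G a b c) = S3 F + S3 G.
Proof.
rewrite /S3; do 3! [rewrite -big_split; apply: eq_bigr => ? _].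
by case: ifP => //=; rewrite addr0.
Qed.

Lemma S4D F G : S4 (fun a b c d => F a b c d + G a b c d) = S4 F + S4 G.
Proof.
rewrite /S4; do 4! [rewrite -big_split; apply: eq_bigr => ? _].
by case: ifP => //=; rewrite addr0.
Qed.

Lemma S2Z k F : S2 (fun a b => k * F a b) = k * S2 F.
Proof.
rewrite /S2; do 2! [rewrite mulr_sumr; apply: eq_bigr => ? _].
by case: ifP => //=; rewrite mulr0.
Qed.

Lemma S3Z k F : S3 (fun a b c => k * F a b c) = k * S3 F.
Proof.
rewrite /S3; do 3! [rewrite mulr_sumr; apply: eq_bigr => ? _].
by case: ifP => //=; rewrite mulr0.
Qed.

Lemma S4Z k F : S4 (fun a b c d => k * F a b c d) = k * S4 F.
Proof.
rewrite /S4; do 4! [rewrite mulr_sumr; apply: eq_bigr => ? _].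
by case: ifP => //=; rewrite mulr0.
Qed.

Lemma S2N F : S2 (fun a b => - F a b) = - S2 F.
Proof. by rewrite -mulN1r -S2Z; apply: eq_S2 => a b _; rewrite mulN1r. Qed.

Lemma S3N F : S3 (fun a b c => - F a b c) = - S3 F.
Proof. by rewrite -mulN1r -S3Z; apply: eq_S3 => a b c _; rewrite mulN1r. Qed.

Lemma S4N F : S4 (fun a b c d => - F a b c d) = - S4 F.
Proof. by rewrite -mulN1r -S4Z; apply: eq_S4 => a b c d _; rewrite mulN1r. Qed.

Lemma S2_const k : S2 (fun _ _ => k) = k * S2 (fun _ _ => 1).
Proof. by rewrite -S2Z; apply: eq_S2 => *; rewrite mulr1. Qed.

Lemma S3_const k : S3 (fun _ _ _ => k) = k * S3 (fun _ _ _ => 1).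
Proof. by rewrite -S3Z; apply: eq_S3 => *; rewrite mulr1. Qed.

Lemma S4_const k : S4 (fun _ _ _ _ => k) = k * S4 (fun _ _ _ _ => 1).
Proof. by rewrite -S4Z; apply: eq_S4 => *; rewrite mulr1. Qed.

Lemma cl3_213 a b c : cl3 b a c = cl3 a b c.
Proof. by rewrite /cl3 (es b a) [e b c && _]andbC. Qed.

Lemma cl3_132 a b c : cl3 a c b = cl3 a b c.
Proof. by rewrite /cl3 (es c b) andbCA. Qed.

Lemma cl4_2134 a b c d : cl4 b a c d = cl4 a b c d.
Proof. by rewrite /cl4 cl3_213 [e b d && _]andbCA. Qed.

Lemma cl4_1324 a b c d : cl4 a c b d = cl4 a b c d.
Proof. by rewrite /cl4 cl3_132 [e c d && _]andbC. Qed.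

Lemma cl4_1243 a b c d : cl4 a b d c = cl4 a b c d.
Proof.
rewrite /cl4 /cl3 (es d c).
by case: (e a b); case: (e a c); case: (e a d); case: (e b c); case: (e b d);
   case: (e c d).
Qed.

Lemma S3_213 F : S3 (fun a b c => F b a c) = S3 F.
Proof.
rewrite /S3 exchange_big; do 3! [apply: eq_bigr => ? _].
by rewrite cl3_213.
Qed.

Lemma S3_132 F : S3 (fun a b c => F a c b) = S3 F.
Proof.
rewrite /S3; apply: eq_bigr => ? _; rewrite exchange_big.
by do 2! [apply: eq_bigr => ? _]; rewrite cl3_132.
Qed.

Lemma S4_2134 F : S4 (fun a b c d => F b a c d) = S4 F.
Proof.
rewrite /S4 exchange_big; do 4! [apply: eq_bigr => ? _].
by rewrite cl4_2134.
Qed.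

Lemma S4_1324 F : S4 (fun a b c d => F a c b d) = S4 F.
Proof.
rewrite /S4; apply: eq_bigr => ? _; rewrite exchange_big.
by do 3! [apply: eq_bigr => ? _]; rewrite cl4_1324.
Qed.

Lemma S4_1243 F : S4 (fun a b c d => F a b d c) = S4 F.
Proof.
rewrite /S4; do 2! [apply: eq_bigr => ? _]; rewrite exchange_big.
by do 2! [apply: eq_bigr => ? _]; rewrite cl4_1243.
Qed.

Lemma codeg2C a b : codeg2 b a = codeg2 a b.
Proof. by apply: eq_bigr => v _; rewrite andbC. Qed.

Lemma codeg3_213 a b c : codeg3 b a c = codeg3 a b c.
Proof. by apply: eq_bigr => v _; rewrite andbCA. Qed.

Lemma codeg3_132 a b c : codeg3 a c b = codeg3 a b c.
Proof. by apply: eq_bigr => v _; rewrite [e c v && _]andbC. Qed.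

Lemma codeg4_2134 a b c d : codeg4 b a c d = codeg4 a b c d.
Proof. by apply: eq_bigr => v _; rewrite andbCA. Qed.

Lemma codeg4_1324 a b c d : codeg4 a c b d = codeg4 a b c d.
Proof. by apply: eq_bigr => v _; rewrite [e c v && _]andbCA. Qed.

Lemma codeg4_1243 a b c d : codeg4 a b d c = codeg4 a b c d.
Proof. by apply: eq_bigr => v _; rewrite [e d v && _]andbC. Qed.

Lemma natz_sum (P : pred V) (F : V -> nat) :
  ((\sum_(v | P v) F v)%N)%:Z = \sum_(v | P v) (F v)%:Z.
Proof. exact: (big_morph Posz PoszD). Qed.

(** Summing out a vertex on which the weight does not depend leaves a codegree. This and [S4_S3]
    carry all the double counting below. *)
Lemma S3_S2 F : S3 (fun a b _ => F a b) = S2 (fun a b => F a b * (codeg2 a b)%:Z).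
Proof.
do 2! [apply: eq_bigr => ? _].
rewrite /cl3; case: ifP => _ /=; last by rewrite big1.
rewrite natz_sum mulr_sumr; apply: eq_bigr => v _.
by case: ifP; rewrite ?mulr1 ?mulr0.
Qed.

Lemma S4_S3 F :
  S4 (fun a b c _ => F a b c) = S3 (fun a b c => F a b c * (codeg3 a b c)%:Z).
Proof.
do 3! [apply: eq_bigr => ? _].
rewrite /cl4; case: ifP => _ /=; last by rewrite big1.
rewrite natz_sum mulr_sumr; apply: eq_bigr => v _.
by case: ifP; rewrite ?mulr1 ?mulr0.
Qed.

Lemma S2_deg F : S2 (fun a _ => F a) = \sum_a F a * (codeg1 a)%:Z.
Proof.
apply: eq_bigr => a _; rewrite natz_sum mulr_sumr; apply: eq_bigr => v _.
by case: ifP; rewrite ?mulr1 ?mulr0.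
Qed.

End OrderedCliqueSums.

(** * Codegree bounds under a minimum degree condition *)

Section HeavyCliques.

Variables (V : finType) (e : rel V) (n q : nat).
Hypothesis es : symmetric e.
Hypothesis cardV : #|V| = n.
Hypothesis hdeg : forall a, (n <= q + codeg1 e a)%N.
Hypotheses (q3n : (3 * q < n)%N) (n4q : (n <= 4 * q)%N).

Local Notation D1 := (codeg1 e).
Local Notation D2 := (codeg2 e).
Local Notation D3 := (codeg3 e).
Local Notation D4 := (codeg4 e).
Local Notation cl3 := (cl3 e).
Local Notation cl4 := (cl4 e).

Lemma card_sum1 : n = (\sum_(v : V) 1)%N.
Proof. by rewrite sum1_card cardV. Qed.

Lemma codeg2_ge a b : (D1 a + D1 b <= D2 a b + n)%N.
Proof.
rewrite card_sum1 -!big_split; apply: leq_sum => v _ /=.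
by case: (e a v); case: (e b v).
Qed.

Lemma codeg3_ge a b c : (D1 a + D2 b c <= D3 a b c + n)%N.
Proof.
rewrite card_sum1 -!big_split; apply: leq_sum => v _ /=.
by case: (e a v); case: (e b v); case: (e c v).
Qed.

Lemma codeg4_ge a b c d : (D1 a + D3 b c d <= D4 a b c d + n)%N.
Proof.
rewrite card_sum1 -!big_split; apply: leq_sum => v _ /=.
by case: (e a v); case: (e b v); case: (e c v); case: (e d v).
Qed.

Lemma codeg3_le_D2 a b c : (D3 a b c <= D2 b c)%N.
Proof. by apply: leq_sum => v _; case: (e a v). Qed.

Lemma codeg2_le_D1 a b : (D2 a b <= D1 b)%N.
Proof. by apply: leq_sum => v _; case: (e a v). Qed.

Lemma codeg4_le_D3 a b c d : (D4 a b c d <= D3 b c d)%N.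
Proof. by apply: leq_sum => v _; case: (e a v). Qed.

Lemma codeg1_le a : (D1 a <= n)%N.
Proof. by rewrite card_sum1; apply: leq_sum => v _; case: (e a v). Qed.

(** Holds vertex by vertex: a vertex adjacent to i of the three satisfies i + [i = 3] <= C(i,2) + 1.
    In the same way [codeg3_sum4] rests on i + 2[i = 4] <= C(i,3) + 2. *)
Lemma codeg2_sum3 a b c :
  (D1 a + D1 b + D1 c + D3 a b c <= D2 a b + D2 a c + D2 b c + n)%N.
Proof.
rewrite card_sum1 -!big_split; apply: leq_sum => v _ /=.
by case: (e a v); case: (e b v); case: (e c v).
Qed.

Lemma codeg3_sum4 a b c d :
  (D1 a + D1 b + D1 c + D1 d + 2 * D4 a b c d <=
   D3 a b c + D3 a b d + D3 a c d + D3 b c d + 2 * n)%N.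
Proof.
rewrite card_sum1 !big_distrr -!big_split; apply: leq_sum => v _ /=.
by case: (e a v); case: (e b v); case: (e c v); case: (e d v).
Qed.

(** Bonferroni's inequality for the neighbourhoods of [c], [x] and [y] inside the common
    neighbourhood of [a] and [b]. *)
Lemma codeg4_link a b c x y :
  (D3 a b c + D3 a b x + D3 a b y <=
   D4 a b c x + D4 a b c y + D4 a b x y + D2 a b)%N.
Proof.
rewrite -!big_split; apply: leq_sum => v _ /=.
by case: (e a v); case: (e b v); case: (e c v); case: (e x v); case: (e y v).
Qed.

Lemma codeg1_bounds a : (n - q <= D1 a <= n)%N.
Proof. by have := hdeg a; have := codeg1_le a; lia. Qed.

Lemma codeg2_bounds a b : (n - 2 * q <= D2 a b <= n)%N.
Proof.
have := codeg2_ge a b; have := codeg2_le_D1 a b; have := codeg1_bounds a.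
by have := codeg1_bounds b; lia.
Qed.

Lemma tri_bounds a b c :
  [/\ (2 * n + D3 a b c <= D2 a b + D2 a c + D2 b c + 3 * q)%N,
      [&& D2 a b <= D3 a b c + q, D2 a c <= D3 a b c + q
        & D2 b c <= D3 a b c + q]%N &
      [&& D3 a b c <= D2 a b, D3 a b c <= D2 a c & D3 a b c <= D2 b c]%N].
Proof.
have [d1 d2 d3] := And3 (codeg1_bounds a) (codeg1_bounds b) (codeg1_bounds c).
have := codeg2_sum3 a b c; have := codeg3_ge a b c; have := codeg3_le_D2 a b c.
have := codeg3_ge b a c; have := codeg3_le_D2 b a c; rewrite codeg3_213.
have := codeg3_ge c a b; have := codeg3_le_D2 c a b; rewrite codeg3_213 codeg3_132.
by split; lia.
Qed.

Lemma codeg3_lower a b c : (n - 3 * q <= D3 a b c)%N.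
Proof. by have := codeg2_bounds a b; have [_ ? _] := tri_bounds a b c; lia. Qed.

Lemma k4_bounds a b c d :
  [/\ (2 * n + 2 * D4 a b c d <=
         D3 a b c + D3 a b d + D3 a c d + D3 b c d + 4 * q)%N,
      [&& D3 a b c <= D4 a b c d + q, D3 a b d <= D4 a b c d + q,
          D3 a c d <= D4 a b c d + q & D3 b c d <= D4 a b c d + q]%N &
      [&& D4 a b c d <= D3 a b c, D4 a b c d <= D3 a b d,
          D4 a b c d <= D3 a c d & D4 a b c d <= D3 b c d]%N].
Proof.
have := codeg1_bounds a; have := codeg1_bounds b; have := codeg1_bounds c.
have := codeg1_bounds d; have := codeg3_sum4 a b c d.
have := codeg4_ge a b c d; have := codeg4_le_D3 a b c d.
have := codeg4_ge b a c d; have := codeg4_le_D3 b a c d; rewrite codeg4_2134.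
have := codeg4_ge c a b d; have := codeg4_le_D3 c a b d; rewrite codeg4_2134 codeg4_1324.
have := codeg4_ge d a b c; have := codeg4_le_D3 d a b c.
by rewrite codeg4_2134 codeg4_1324 codeg4_1243; split; lia.
Qed.

(** * Heavy cliques, truncated codegrees and slacks *)

Definition heavy2 a b := (2 * q < D2 a b)%N.
Definition heavy3 a b c := (q < D3 a b c)%N.
Definition excess2 a b := (D2 a b - 2 * q)%N.
Definition excess3 a b c := (D3 a b c - q)%N.
Definition trunc2 a b := minn (D2 a b) (2 * q).
Definition trunc3 a b c := minn (D3 a b c) q.

(** Slack in the first inequalities of [tri_bounds] and [k4_bounds] once codegrees are truncated;
    for 4-cliques the term in [D4] is dropped. *)
Definition slack3 a b c : int :=
  (trunc2 a b + trunc2 a c + trunc2 b c)%:Z - (2 * n%:Z - 3 * q%:Z) - (trunc3 a b c)%:Z.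
Definition slack4 a b c d : int :=
  (trunc3 a b c + trunc3 a b d + trunc3 a c d + trunc3 b c d)%:Z - (2 * n%:Z - 4 * q%:Z).

(* Only triangles with exactly one heavy edge (here ab) can have a deficit that their own
   slack does not cover; [share] is what each of them receives from the slack of a
   4-clique containing it. *)
Definition needy a b c := [&& heavy2 a b, ~~ heavy2 a c & ~~ heavy2 b c].

Definition nheavy a b c d :=
  (heavy3 a b c + heavy3 a b d + heavy3 a c d + heavy3 b c d)%N.
Definition share a b c d : int :=
  if (2 < nheavy a b c d)%N then 4 * q%:Z - n%:Z else slack4 a b c d.

Ltac heavy_lia :=
  rewrite /share /slack3 /slack4 /nheavy /needy /heavy2 /heavy3;
  rewrite /excess2 /excess3 /trunc2 /trunc3; lia.

(** Truncating a heavy triangle loses at most [D4], so two of them are absorbed by the term [2 * D4]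
    of [k4_bounds]. With three, the truncated sum is at least 3q + (n - 3q) = n, which is at least
    2n - 4q. *)
Lemma slack4_ge0 a b c d : 0 <= slack4 a b c d.
Proof.
have [? ? ?] := k4_bounds a b c d.
have := codeg3_lower a b c; have := codeg3_lower a b d.
have := codeg3_lower a c d; have := codeg3_lower b c d.
heavy_lia.
Qed.

Lemma slack4_three a b c d :
  nheavy a b c d = 3%N -> 4 * q%:Z - n%:Z <= slack4 a b c d.
Proof.
have := codeg3_lower a b c; have := codeg3_lower a b d.
have := codeg3_lower a c d; have := codeg3_lower b c d.
heavy_lia.
Qed.

Lemma slack4_four a b c d :
  nheavy a b c d = 4%N -> slack4 a b c d = 2 * (4 * q%:Z - n%:Z).
Proof. heavy_lia. Qed.

Lemma heavy2_heavy3 a b c :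
  [/\ heavy2 a b -> heavy3 a b c, heavy2 a c -> heavy3 a b c
    & heavy2 b c -> heavy3 a b c].
Proof. by have [_ ? _] := tri_bounds a b c; split; heavy_lia. Qed.

Lemma share_ge0 a b c d : 0 <= share a b c d.
Proof. by rewrite /share; case: ifP => _; [lia | exact: slack4_ge0]. Qed.

Lemma slack3_ge0 a b c : 0 <= slack3 a b c.
Proof.
have [? ? ?] := tri_bounds a b c.
have := codeg2_bounds a b; have := codeg2_bounds a c; have := codeg2_bounds b c.
heavy_lia.
Qed.

Lemma heavy2C a b : heavy2 b a = heavy2 a b.
Proof. by rewrite /heavy2 codeg2C. Qed.

Lemma slack4_2134 a b c d : slack4 b a c d = slack4 a b c d.
Proof. by rewrite /slack4 /trunc3 (codeg3_213 e a b c) (codeg3_213 e a b d); lia. Qed.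

Lemma slack4_1324 a b c d : slack4 a c b d = slack4 a b c d.
Proof. by rewrite /slack4 /trunc3 (codeg3_132 e a b c) (codeg3_213 e b c d); lia. Qed.

Lemma slack4_1243 a b c d : slack4 a b d c = slack4 a b c d.
Proof. by rewrite /slack4 /trunc3 (codeg3_132 e a c d) (codeg3_132 e b c d); lia. Qed.

Lemma nheavy_2134 a b c d : nheavy b a c d = nheavy a b c d.
Proof. by rewrite /nheavy /heavy3 (codeg3_213 e a b c) (codeg3_213 e a b d); lia. Qed.

Lemma nheavy_1324 a b c d : nheavy a c b d = nheavy a b c d.
Proof. by rewrite /nheavy /heavy3 (codeg3_132 e a b c) (codeg3_213 e b c d); lia. Qed.

Lemma nheavy_1243 a b c d : nheavy a b d c = nheavy a b c d.
Proof. by rewrite /nheavy /heavy3 (codeg3_132 e a c d) (codeg3_132 e b c d); lia. Qed.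

Lemma share_2134 a b c d : share b a c d = share a b c d.
Proof. by rewrite /share nheavy_2134 slack4_2134. Qed.

Lemma share_1324 a b c d : share a c b d = share a b c d.
Proof. by rewrite /share nheavy_1324 slack4_1324. Qed.

Lemma share_1243 a b c d : share a b d c = share a b c d.
Proof. by rewrite /share nheavy_1243 slack4_1243. Qed.

(** Each edge of a 4-clique lies in two of its triangles, so the numbers of heavy edges in the four
    triangles have an even sum. Hence three triangles with exactly one heavy edge force a heavy edge
    in the fourth, and then all four triangles are heavy. *)
Lemma heavy_pattern (ab ac ad bc bd cd abc abd acd bcd : bool) :
  let ex1 x y z := ([&& x, ~~ y & ~~ z] + [&& y, ~~ x & ~~ z]
                    + [&& z, ~~ x & ~~ y])%N in
  let needs := (ex1 ab ac bc + ex1 ab ad bd + ex1 ac ad cd + ex1 bc bd cd)%N in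
  let k := (abc + abd + acd + bcd)%N in
  [|| ab, ac | bc] ==> abc -> [|| ab, ad | bd] ==> abd ->
  [|| ac, ad | cd] ==> acd -> [|| bc, bd | cd] ==> bcd ->
  (needs <= if k == 4 then 4 else 2)%N.
Proof.
by move: ab ac ad bc bd cd abc abd acd bcd; do 10 case.
Qed.

Definition nneedy a b c := (needy a b c + needy a c b + needy b c a)%N.

(** At most two triangles are needy unless all four are heavy. In the exceptional case up to four
    may be needy, but then the slack is twice the share by [slack4_four]; otherwise the slack is at
    least the share. *)
Lemma share_needy a b c d :
  ((nneedy a b c + nneedy a b d + nneedy a c d + nneedy b c d)%N)%:Z
    * share a b c d <= 2 * slack4 a b c d.
Proof.
set k := (_ + _ + _ + _)%N.
have kle : (k <= if nheavy a b c d == 4 then 4 else 2)%N.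
  rewrite /k /nneedy /needy.
  rewrite !(heavy2C a b, heavy2C a c, heavy2C a d, heavy2C b c, heavy2C b d, heavy2C c d).
  have := @heavy_pattern (heavy2 a b) (heavy2 a c) (heavy2 a d) (heavy2 b c) (heavy2 b d)
    (heavy2 c d) (heavy3 a b c) (heavy3 a b d) (heavy3 a c d) (heavy3 b c d).
  apply; apply/implyP => /or3P.
  - by have [? ? ?] := heavy2_heavy3 a b c; case.
  - by have [? ? ?] := heavy2_heavy3 a b d; case.
  - by have [? ? ?] := heavy2_heavy3 a c d; case.
  - by have [? ? ?] := heavy2_heavy3 b c d; case.
have nh4 : (nheavy a b c d <= 4)%N by rewrite /nheavy; do 4!case: heavy3.
have s0 := slack4_ge0 a b c d; move: kle; rewrite /share.
case: ltnP => h3; last first.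
  have -> : (nheavy a b c d == 4) = false by lia.
  by move=> k2; nia.
case: eqP => [/slack4_four -> |h4 k2]; first by nia.
have : nheavy a b c d = 3%N by lia.
by move/slack4_three; nia.
Qed.

Lemma no_heavy_edge_arith (k N s t : int) (z : bool) :
  0 <= k < N -> t <= s -> 0 <= t -> (z -> 0 < t) -> k * t + z%:Z <= N * s.
Proof. by case: z => ? ? ? H; [have {}H := H isT|]; nia. Qed.

Lemma one_heavy_edge_arith (k N s t h : int) :
  0 <= k < N -> 0 <= s -> t - h <= s -> h <= t -> k * t <= N * s + k * h.
Proof. by nia. Qed.

Lemma two_heavy_edges_arith (k N s t : int) :
  0 <= k < N -> k <= s -> t <= 2 * N -> (N < t -> 2 * k <= s) -> k * t <= N * s.
Proof.
move=> kN ks t2; case: (leP t N) => tN => [_|/(_ isT)] ; nia.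
Qed.

(** Write k = 4q - n and N = n - 2q, so that k < N. Without heavy edges the slack is at least the
    excess of the triangle. With one heavy edge it is so after subtracting the excess of that edge.
    With two it is at least k, with three it is 2k, and an excess above N forces the third edge to
    be heavy. The extra unit for a heavy triangle without heavy edges comes from k < N. *)
Lemma slack3_needy a b c :
  (4 * q%:Z - n%:Z) * (excess3 a b c)%:Z
    + (heavy3 a b c && ~~ [|| heavy2 a b, heavy2 a c | heavy2 b c])%:Z <=
  (n%:Z - 2 * q%:Z) * slack3 a b c + (4 * q%:Z - n%:Z) *
    (needy a b c * excess2 a b + needy a c b * excess2 a c
     + needy b c a * excess2 b c)%:Z.
Proof.
have [T1 T2 T3] := tri_bounds a b c; have s0 := slack3_ge0 a b c.
have B1 := codeg2_bounds a b; have B2 := codeg2_bounds a c; have B3 := codeg2_bounds b c.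
rewrite /needy !(heavy2C a b, heavy2C a c, heavy2C b c).
have kN : 0 <= 4 * q%:Z - n%:Z < n%:Z - 2 * q%:Z by lia.
case E1: (heavy2 a b); case E2: (heavy2 a c); case E3: (heavy2 b c) => /=;
  move: E1 E2 E3; rewrite ?andbT ?andbF ?mul0n ?mul1n ?addn0 ?add0n => E1 E2 E3.
- rewrite addr0 mulr0 addr0; apply: two_heavy_edges_arith => //;
    by move: E1 E2 E3; heavy_lia.
- rewrite addr0 mulr0 addr0; apply: two_heavy_edges_arith => //;
    by move: E1 E2 E3; heavy_lia.
- rewrite addr0 mulr0 addr0; apply: two_heavy_edges_arith => //;
    by move: E1 E2 E3; heavy_lia.
- by rewrite addr0; apply: one_heavy_edge_arith => //; move: E1 E2 E3; heavy_lia.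
- rewrite addr0 mulr0 addr0; apply: two_heavy_edges_arith => //;
    by move: E1 E2 E3; heavy_lia.
- by rewrite addr0; apply: one_heavy_edge_arith => //; move: E1 E2 E3; heavy_lia.
- by rewrite addr0; apply: one_heavy_edge_arith => //; move: E1 E2 E3; heavy_lia.
- by rewrite mulr0 addr0; apply: no_heavy_edge_arith => //; move: E1 E2 E3; heavy_lia.
Qed.

(** * Paying for the needy triangles on a heavy edge *)

Definition cov a b c : int :=
  \sum_x if cl4 a b c x then share a b c x else 0.

Definition needy_triangle a b c := cl3 a b c && needy a b c.

Lemma heavy2_nheavy a b c x : heavy2 a b -> (1 < nheavy a b c x)%N.
Proof.
by move=> h; have [H1 _ _] := heavy2_heavy3 a b c; have [H2 _ _] := heavy2_heavy3 a b x;
   rewrite /nheavy H1 ?H2.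
Qed.

(** When only [a b c] and [a b x] are heavy, the other two triangles have codegree at least [D4],
    which is at least the excess of the edge [a b]. This yields the bound 2(excess - (n - 3q)). *)
Lemma share_lower (m : int) a b c x : heavy2 a b -> m <= 4 * q%:Z - n%:Z ->
  m <= 2 * ((excess2 a b)%:Z - (n%:Z - 3 * q%:Z)) -> m <= share a b c x.
Proof.
move=> h; have := heavy2_nheavy c x h.
have [? ? ?] := k4_bounds a b c x; have [? ? ?] := tri_bounds a b c.
rewrite /share; case: ifP => // k3 k2 _ mle; apply: le_trans mle _.
move: h k2 k3; heavy_lia.
Qed.

Lemma slack4_two a b c x : heavy2 a b -> (nheavy a b c x <= 2)%N ->
  [/\ heavy3 a b c, heavy3 a b x,
      2 * (D4 a b c x)%:Z + 2 * q%:Z - (D3 a b c)%:Z - (D3 a b x)%:Z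
        <= slack4 a b c x &
      2 * ((D4 a b c x)%:Z - (n%:Z - 3 * q%:Z)) <= slack4 a b c x].
Proof.
move=> hab k2; have [H1 _ _] := heavy2_heavy3 a b c; have [H2 _ _] := heavy2_heavy3 a b x.
have {H1 H2}[H1 H2] := (H1 hab, H2 hab).
have [? ? ?] := k4_bounds a b c x.
by split => //; move: k2 H1 H2; heavy_lia.
Qed.

(** The independence property: if adjacent [c] and [x] span with [a b] a 4-clique of small share,
    their deficits add up to at most the full demand (4q - n) times the excess of [a b]. *)
Lemma cov_pair a b c x :
  heavy2 a b -> needy_triangle a b c -> needy_triangle a b x -> e c x ->
  share a b c x < 4 * q%:Z - n%:Z ->
  (4 * q%:Z - n%:Z) * (excess2 a b)%:Z <= cov a b c + cov a b x.
Proof.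
move=> hab /andP[cabc _] /andP[cabx _] ecx scx.
have [T1 T2 T3] := k4_bounds a b c x; have [U1 U2 U3] := tri_bounds a b c.
have pD : (4 * q%:Z - n%:Z) * (excess2 a b)%:Z
    <= (4 * q%:Z - n%:Z) * (D4 a b c x)%:Z.
  by apply: ler_wpM2l; [lia | move: hab; heavy_lia].
apply: le_trans pD _; rewrite /codeg4 natz_sum mulr_sumr.
(* As [D4 a b c x] is at least the excess of [a b], it suffices that each common neighbour [y] of
   all four vertices contributes at least 4q - n to the two sums together. This is clear when one of
   its two 4-cliques has three heavy triangles. *)
rewrite /cov -big_split; apply: ler_sum => y _ /=.
have := share_ge0 a b c y; have := share_ge0 a b x y.
case: andP => [[ay /and3P[bY cy xy]]|_]; last by case: ifP; case: ifP; lia.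
rewrite /cl4 cabc cabx ay bY cy xy /=.
have [T1' T2' T3'] := k4_bounds a b c y.
have [T1'' T2'' T3''] := k4_bounds a b x y.
have L := codeg4_link a b c x y.
have [V1 V2 V3] := tri_bounds a b x; have [W1 W2 W3] := tri_bounds a b y.
move: scx; rewrite /share.
case: ifP => [k1|/negbT]; [by lia|rewrite -leqNgt => k1].
case: ifP => [k2|/negbT]; [by lia|rewrite -leqNgt => k2].
case: ifP => [k3|/negbT]; [by lia|rewrite -leqNgt => k3].
have [_ _ A1 A2] := slack4_two hab k1; have [_ _ A3 A4] := slack4_two hab k2.
have [_ _ A5 A6] := slack4_two hab k3.
(* Linear arithmetic remains. [L] with the odd-numbered bounds gives one lower estimate of the two
   shares, [L] with the even-numbered ones and the lower bounds on the [D3] another. Weighting them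
   2 to 1 cancels [D2 a b] and leaves 4q - n. *)
move: hab L U2 V2 W2 A1 A2 A3 A4 A5 A6; rewrite /heavy2.
move: (slack4 _ _ _ _) (slack4 _ _ _ _) (slack4 _ _ _ _) => s1 s2 s3.
move: (D4 a b c x) (D4 a b c y) (D4 a b x y) => d1 d2 d3.
move: (D3 a b c) (D3 a b x) (D3 a b y) (D2 a b) => t1 t2 t3 m.
move=> hab L /and3P[U _ _] /and3P[W _ _] /and3P[Y _ _].
clear - q3n n4q hab L U W Y.
lia.
Qed.

Lemma cov_dense_arith (k g N Q h : int) : 0 <= k -> k <= Q -> 0 < N -> 0 < h ->
  3 * k <= N -> 2 * N * g <= k * h -> k * h <= 2 * (h - g) * (Q + h).
Proof.
move=> k0 kQ N0 h0 kN gle.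
have A : h * N <= 2 * (h - g) * N by nia.
have B : h <= 2 * (h - g) by rewrite -(ler_pM2r N0).
by nia.
Qed.

Lemma cov_ge m a b c : cl3 a b c -> 0 <= m ->
  (forall x, m <= share a b c x) -> m * (D3 a b c)%:Z <= cov a b c.
Proof.
move=> cabc m0 mle; rewrite /cov natz_sum mulr_sumr; apply: ler_sum => x _.
by rewrite /cl4 cabc /=; case: ifP; rewrite ?mulr1 ?mulr0.
Qed.

(** For a large excess even the uniform bound of [share_lower], summed over the at least q + excess
    common neighbours of the triangle, meets the whole demand. *)
Lemma cov_dense a b c : heavy2 a b -> needy_triangle a b c ->
  2 * n%:Z * (n%:Z - 3 * q%:Z) <= (4 * q%:Z - n%:Z) * (excess2 a b)%:Z ->
  (4 * q%:Z - n%:Z) * (excess2 a b)%:Z <= cov a b c.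
Proof.
move=> hab /andP[cabc _] Xle; have [_ T _] := tri_bounds a b c.
have h0 : 0 < (excess2 a b)%:Z by move: hab; heavy_lia.
have tD : (excess2 a b)%:Z + q%:Z <= (D3 a b c)%:Z by move: hab T; heavy_lia.
have M0 := @cov_dense_arith (4 * q%:Z - n%:Z) (n%:Z - 3 * q%:Z) n%:Z q%:Z
  (excess2 a b)%:Z.
have {}M0 := M0 ltac:(lia) ltac:(lia) ltac:(lia) h0 ltac:(lia) Xle.
have k0 : 0 <= 4 * q%:Z - n%:Z by lia.
set m := 2 * ((excess2 a b)%:Z - (n%:Z - 3 * q%:Z)) in M0 *.
have [km|mk] := lerP (4 * q%:Z - n%:Z) m.
- have := cov_ge cabc k0 (fun x => share_lower c x hab (lexx _) km); nia.
- have m0 : 0 <= m by nia.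
  have := cov_ge cabc m0 (fun x => share_lower c x hab (ltW mk) (lexx _)); nia.
Qed.

Definition dense a b c x := cl4 a b c x && (4 * q%:Z - n%:Z <= share a b c x).

Lemma cov_ge_dense a b c :
  (4 * q%:Z - n%:Z) * ((\sum_x dense a b c x)%N)%:Z <= cov a b c.
Proof.
rewrite /cov natz_sum mulr_sumr; apply: ler_sum => x _.
rewrite /dense; case: ifP => _ /=; last by rewrite mulr0.
by case: (lerP (_ - _) (share _ _ _ _)) => [h|_] /=; rewrite ?mulr1 ?mulr0 ?share_ge0.
Qed.

(** Since 2U > X, the left side increases with r, so r may be replaced by Q + j. Then j is bounded
    through k j <= X - U, and 4U(X - U) <= X^2 finishes. *)
Lemma fractional_arith (k g N Q h X U m r j : int) :
  0 <= k -> X = k * h -> 0 < h -> X < 2 * N * g ->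
  m = 2 * Q + h -> k * j <= X - U -> X < 2 * U -> r <= Q + j ->
  r * U + (m - r) * (X - U) < (Q * k + N * g) * h.
Proof.
move=> k0 EX h0 Xlt -> kj XU rQ.
have k1 : 0 < k.
  rewrite lt_neqAle k0 andbT; apply/eqP => k0'; move: kj XU.
  by rewrite EX -k0' !mul0r; lia.
have A : r * (2 * U - X) <= (Q + j) * (2 * U - X) by rewrite ler_pM2r //; lia.
have C : k * j * (2 * U - X) <= (X - U) * (2 * U - X).
  by rewrite ler_pM2r //; lia.
have D : 4 * ((X - U) * U) <= X ^+ 2.
  by have := sqr_ge0 (X - 2 * U); nia.
have B : 2 * (h * (X - U) + j * (2 * U - X)) <= h * X.
  rewrite -(ler_pM2l k1).
  have -> : k * (2 * (h * (X - U) + j * (2 * U - X)))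
    = 2 * (X * (X - U) + k * j * (2 * U - X)) by rewrite EX; ring.
  have -> : k * (h * X) = X ^+ 2 by rewrite EX; ring.
  by nia.
have E : h * X < h * (2 * N * g) by rewrite ltr_pM2l.
by nia.
Qed.

(* The deficits [u c] behave like weights of a fractional independent set of the
   common neighbourhood of [a] and [b], where independent sets have size at most q. *)
Lemma needy_cov a b : heavy2 a b ->
  \sum_(c | needy_triangle a b c) (4 * q%:Z - n%:Z) * (excess2 a b)%:Z <
  \sum_(c | needy_triangle a b c) cov a b c + (n%:Z - 2 * q%:Z) ^+ 2 * (excess2 a b)%:Z.
Proof.
move=> hab; set X := (_ * (excess2 a b)%:Z).
rewrite -ltrBlDl -sumrB; set u := fun c => X - cov a b c.
have h0 : 0 < (excess2 a b)%:Z by move: hab; heavy_lia.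
have R0 : 0 < (n%:Z - 2 * q%:Z) ^+ 2 * (excess2 a b)%:Z.
  by rewrite mulr_gt0 // exprn_gt0 //; lia.
have [c0 ndy0|none] := pickP (needy_triangle a b); last by rewrite big_pred0.
(* For a large demand [X] every deficit is nonpositive. *)
have [Xge|Xlt] := lerP (2 * n%:Z * (n%:Z - 3 * q%:Z)) X.
  apply: le_lt_trans R0; apply: sumr_le0 => c ndyc.
  by rewrite subr_le0 cov_dense.
have [c ndyc umax] := @Order.TotalTheory.arg_maxP _ int V c0 (needy_triangle a b) u ndy0.
set U := u c in umax; have X0 : 0 <= X by rewrite mulr_ge0 //; lia.
have cU : cov a b c = X - U by rewrite /U /u; lia.
have Dm : (D2 a b)%:Z = 2 * q%:Z + (excess2 a b)%:Z by move: hab; heavy_lia.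
have sqE : (n%:Z - 2 * q%:Z) ^+ 2
    = q%:Z * (4 * q%:Z - n%:Z) + n%:Z * (n%:Z - 3 * q%:Z) by ring.
have restrict (F : V -> int) : (forall x, 0 <= F x) ->
    (forall x, needy_triangle a b x -> u x <= F x) ->
    \sum_(x | needy_triangle a b x) u x <= \sum_x (e a x && e b x)%:Z * F x.
  move=> F0 uF; rewrite big_mkcond /=; apply: ler_sum => x _.
  case: ifP => [ndyx|_]; last by rewrite mulr_ge0.
  by move: (ndyx) => /andP[/and3P[_ -> ->] _]; rewrite mul1r uF.
(* If no deficit exceeds half of [X], the trivial bound by the number [D2 a b] of common neighbours
   suffices. The half is rounded down because all weights are integers. *)
have [Usmall|Ubig] := lerP (2 * U) X.
  have Uh x : needy_triangle a b x -> u x <= (X %/ 2)%Z.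
    by move/umax; rewrite -/U; lia.
  apply: le_lt_trans (restrict (fun=> (X %/ 2)%Z) _ Uh) _; first by lia.
  rewrite -mulr_suml -natz_sum -/(D2 a b) Dm sqE.
  have : 2 * (X %/ 2)%Z <= X by lia.
  move: (X %/ 2)%Z => Y YX; rewrite -(@ltr_pM2l _ 2) //.
  apply: (@le_lt_trans _ _ ((2 * q%:Z + (excess2 a b)%:Z) * X)); first by nia.
  have EX : X = (4 * q%:Z - n%:Z) * (excess2 a b)%:Z by [].
  by nia.
have kj := cov_ge_dense a b c; rewrite cU in kj.
set j := (\sum_x _)%N in kj.
(* Here [c] has the largest deficit [U]. On [R] only [u x <= U] is known; off [R], [cov_pair] gives
   [u x <= X - U]. [F] records both bounds. *)
pose R x := ~~ e c x || dense a b c x.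
have XU : 0 <= X - U by apply: le_trans kj; rewrite mulr_ge0 //; lia.
pose F x := (R x)%:Z * (2 * U - X) + (X - U).
have F0 x : 0 <= F x by rewrite /F; case: (R x); lia.
have uF x : needy_triangle a b x -> u x <= F x.
  move=> ndyx; rewrite /F /R; have := umax x ndyx; rewrite -/U.
  case ecx: (e c x); last by rewrite /=; lia.
  case: (boolP (dense _ _ _ _)) => /=; first by lia.
  have [cabc _] := andP ndyc; have [/and3P[_ eax ebx] _] := andP ndyx.
  rewrite /dense /cl4 cabc eax ebx ecx /= -ltNge => sh.
  by have := cov_pair hab ndyc ndyx ecx sh; rewrite /u; lia.
apply: le_lt_trans (restrict F F0 uF) _.
pose r := (\sum_x (e a x && e b x && R x))%N.
have -> : \sum_x (e a x && e b x)%:Z * F x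
    = r%:Z * U + ((D2 a b)%:Z - r%:Z) * (X - U).
  rewrite /r /codeg2 !natz_sum mulrBl.
  rewrite [X in _ = X](_ : _ = \sum_x (e a x && e b x && R x)%:Z * (2 * U - X)
     + \sum_x (e a x && e b x)%:Z * (X - U)); last first.
    by rewrite -!mulr_suml; ring.
  rewrite -big_split; apply: eq_bigr => x _ /=; rewrite /F.
  by case: (e a x && e b x); case: (R x) => /=; ring.
rewrite sqE Dm.
apply: (@fractional_arith (4 * q%:Z - n%:Z) _ _ _ _ X U _ _ j%:Z) => //; try lia.
have -> : q%:Z + j%:Z = (q + j)%N%:Z by [].
(* [R] consists of at most [q] non-neighbours of [c], by the degree hypothesis, and of the dense
   vertices, which [j] counts. *)
rewrite lez_nat; have : (\sum_x (~~ e c x : nat) <= q)%N.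
  have : (\sum_x (~~ e c x : nat) + D1 c = n)%N.
    rewrite card_sum1 -big_split; apply: eq_bigr => x _ /=.
    by case: (e c x).
  by have := hdeg c; lia.
move=> le; apply: (@leq_trans (\sum_x (~~ e c x : nat) + j)); last by rewrite leq_add2r.
rewrite /j /r -big_split; apply: leq_sum => x _ /=.
by rewrite /R; case: (e a x && e b x); case: (e c x); case: (dense _ _ _ _).
Qed.

(** * Double counting identities *)

Local Notation S2 := (S2 e).
Local Notation S3 := (S3 e).
Local Notation S4 := (S4 e).
Local Notation k := (4 * q%:Z - n%:Z).
Local Notation g := (n%:Z - 3 * q%:Z).
Local Notation N := (n%:Z - 2 * q%:Z).

Let X2 := S2 (fun _ _ => 1).
Let X3 := S3 (fun _ _ _ => 1).
Let X4 := S4 (fun _ _ _ _ => 1).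
Let H3 := S3 (fun a b c => (excess3 a b c)%:Z).
Let H2 := S2 (fun a b => (excess2 a b)%:Z).
Let A := S4 slack4.
Let B := S3 slack3.
(** Truncated codegrees of triangles lie between [g] and [q], those of edges between [N] and 2q. The
    products in [A2] and [B2] are therefore nonnegative and vanish exactly at the end points. *)
Let A2 := S3 (fun a b c => ((trunc3 a b c)%:Z - g) * (q%:Z - (trunc3 a b c)%:Z)).
Let B2 := S2 (fun a b => ((trunc2 a b)%:Z - N) * (2 * q%:Z - (trunc2 a b)%:Z)).
Let Z2 := S2 (fun a b => (heavy2 a b)%:Z).
Let Z3 := S3 (fun a b c =>
  (heavy3 a b c && ~~ [|| heavy2 a b, heavy2 a c | heavy2 b c])%:Z).
Let W := S4 (fun a b c d => (needy a b c)%:Z * share a b c d).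

Lemma S3_D2 : S2 (fun a b => (D2 a b)%:Z) = X3.
Proof.
by rewrite /X3 (S3_S2 e (fun _ _ => 1)); apply: eq_S2 => a b _; rewrite mul1r.
Qed.

Lemma S4_D3 : S3 (fun a b c => (D3 a b c)%:Z) = X4.
Proof.
by rewrite /X4 (S4_S3 e (fun _ _ _ => 1)); apply: eq_S3 => *; rewrite mul1r.
Qed.

Lemma S3_231 F : S3 (fun a b c => F b c a) = S3 F.
Proof.
by rewrite -[RHS](S3_132 es F) -[RHS](S3_213 es (fun a b c => F a c b)).
Qed.

Lemma S4_four F : (forall a b c, F b a c = F a b c) ->
  S4 (fun a b c d => F a b c + F a b d + F a c d + F b c d)
  = 4 * S4 (fun a b c _ => F a b c).
Proof.
move=> Fs; rewrite !S4D.
have E1 : S4 (fun a b c d => F a b d) = S4 (fun a b c _ => F a b c).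
  by rewrite -(S4_1243 es (fun a b c _ => F a b c)).
have E2 : S4 (fun a b c d => F a c d) = S4 (fun a b c _ => F a b c).
  by rewrite -E1 -(S4_1324 es (fun a b c d => F a b d)).
have E3 : S4 (fun a b c d => F b c d) = S4 (fun a b c _ => F a b c).
  by rewrite -E2 -(S4_2134 es (fun a b c d => F a c d)).
by rewrite E1 E2 E3; ring.
Qed.

(** Summing [slack4] weights each triangle by its truncated codegree times its codegree. That
    product is linear in the codegree up to the excess and the quadratic term collected in [A2].
    [K3_identity] is the analogue with [slack3] and edges. *)
Lemma K4_identity :
  (2 * n%:Z - 4 * q%:Z) * X4 = 4 * q%:Z * g * X3 + 4 * g * H3 + A + 4 * A2.
Proof.
have EA : A = 4 * S4 (fun a b c _ => (trunc3 a b c)%:Z)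
              - (2 * n%:Z - 4 * q%:Z) * X4.
  rewrite -S4_four; last by move=> a b c; rewrite /trunc3 codeg3_213.
  rewrite -S4_const -S4N -S4D; apply: eq_S4 => a b c d _.
  by rewrite /slack4 !PoszD.
have ED : S3 (fun a b c => (trunc3 a b c)%:Z * (D3 a b c)%:Z)
    = N * X4 - q%:Z * g * X3 - g * H3 - A2.
  rewrite -S4_D3 -S3_const /H3 /A2 -!S3Z -!S3N -!S3D; apply: eq_S3 => a b c _.
  rewrite /trunc3 /excess3; move: (D3 a b c) => t.
  have [tq|qt] := leqP t q.
    have -> : (t - q = 0)%N by lia.
    by ring.
  by rewrite -subzn; [ring | lia].
by rewrite S4_S3 ED in EA; rewrite EA; ring.
Qed.

Lemma K3_identity :
  (n%:Z + 3 * q%:Z) * X3 =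
  X4 - H3 + B + 6 * q%:Z * N * X2 + 3 * N * H2 + 3 * B2.
Proof.
have EB : B = 3 * S3 (fun a b _ => (trunc2 a b)%:Z)
              - (2 * n%:Z - 3 * q%:Z) * X3 - (X4 - H3).
  have E1 : S3 (fun a b c => (trunc2 a c)%:Z) = S3 (fun a b _ => (trunc2 a b)%:Z).
    by rewrite -(S3_132 es (fun a b _ => (trunc2 a b)%:Z)).
  have E2 : S3 (fun a b c => (trunc2 b c)%:Z) = S3 (fun a b _ => (trunc2 a b)%:Z).
    by rewrite -E1 -(S3_213 es (fun a b c => (trunc2 a c)%:Z)).
  have -> : 3 * S3 (fun a b _ => (trunc2 a b)%:Z)
    = S3 (fun a b _ => (trunc2 a b)%:Z) + S3 (fun a b c => (trunc2 a c)%:Z)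
      + S3 (fun a b c => (trunc2 b c)%:Z) by rewrite E1 E2; ring.
  rewrite -S4_D3 -S3_const /H3 /B -!S3N -!S3D -!S3N -!S3D.
  apply: eq_S3 => a b c _; rewrite /slack3 /trunc3 /excess3.
  by lia.
have ED : S2 (fun a b => (trunc2 a b)%:Z * (D2 a b)%:Z)
    = n%:Z * X3 - 2 * q%:Z * N * X2 - N * H2 - B2.
  rewrite -S3_D2 -S2_const /H2 /B2 -!S2Z -!S2N -!S2D; apply: eq_S2 => a b _.
  rewrite /trunc2 /excess2; move: (D2 a b) => t.
  have [tq|qt] := leqP t (2 * q).
    have -> : (t - 2 * q = 0)%N by lia.
    by ring.
  by rewrite -subzn; [rewrite PoszM; ring | lia].
by rewrite S3_S2 ED in EB; rewrite EB; ring.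
Qed.

(** Eliminates [X4] between the two identities. The bracket is the only part of uncertain sign;
    [heavy_deficit] bounds it below. *)
Lemma main_identity :
  2 * n%:Z * (n%:Z - q%:Z) * X3 =
  12 * q%:Z * N ^+ 2 * X2 + (A + 6 * N ^+ 2 * H2 + 2 * N * B - 2 * k * H3)
  + 4 * A2 + 6 * N * B2.
Proof.
have E4 := K4_identity; have E3 := K3_identity.
have : (2 * n%:Z - 4 * q%:Z) * ((n%:Z + 3 * q%:Z) * X3) =
  (2 * n%:Z - 4 * q%:Z) * X4 + (2 * n%:Z - 4 * q%:Z) *
  (- H3 + B + 6 * q%:Z * N * X2 + 3 * N * H2 + 3 * B2).
  by rewrite E3; ring.
rewrite E4 => E.
have -> : 2 * n%:Z * (n%:Z - q%:Z) * X3 =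
  (2 * n%:Z - 4 * q%:Z) * ((n%:Z + 3 * q%:Z) * X3) - 4 * q%:Z * g * X3 by ring.
by rewrite E; ring.
Qed.

(** Summing over the twelve choices of a triangle in the 4-clique and an edge of that triangle turns
    [share_needy] into 12 W <= 2 A. *)
Lemma W_le : 6 * W <= A.
Proof.
have sh1 := share_2134; have sh2 := share_1324; have sh3 := share_1243.
pose G a b c d := (nneedy a b c)%:Z * share a b c d.
have EG : S4 G = 3 * W.
  have E1 : S4 (fun a b c d => (needy a c b)%:Z * share a b c d) = W.
    rewrite -(S4_1324 es); apply: eq_S4 => a b c d _; by rewrite sh2.
  have E2 : S4 (fun a b c d => (needy b c a)%:Z * share a b c d) = W.
    rewrite -E1 -[RHS](S4_2134 es); apply: eq_S4 => a b c d _; by rewrite sh1.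
  have -> : 3 * W = W + W + W by ring.
  rewrite -{2}E1 -{2}E2 -!S4D; apply: eq_S4 => a b c d _.
  by rewrite /G /nneedy !PoszD; ring.
have E1 : S4 (fun a b c d => (nneedy a b d)%:Z * share a b c d) = S4 G.
  by rewrite -(S4_1243 es); apply: eq_S4 => a b c d _; rewrite sh3.
have E2 : S4 (fun a b c d => (nneedy a c d)%:Z * share a b c d) = S4 G.
  by rewrite -E1 -[RHS](S4_1324 es); apply: eq_S4 => a b c d _; rewrite sh2.
have E3 : S4 (fun a b c d => (nneedy b c d)%:Z * share a b c d) = S4 G.
  by rewrite -E2 -[RHS](S4_2134 es); apply: eq_S4 => a b c d _; rewrite sh1.
suff: 4 * (3 * W) <= 2 * A by lia.
have -> : 4 * (3 * W) = S4 G + S4 G + S4 G + S4 G by rewrite EG; ring.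
rewrite -{2}E1 -{2}E2 -{2}E3 -!S4D -S4Z; apply: le_S4 => a b c d _.
apply: le_trans (share_needy a b c d).
by rewrite /G !PoszD le_eqVlt; apply/orP; left; apply/eqP; ring.
Qed.

(** Sums [needy_cov] over the heavy edges. Its strict inequality between integers yields one spare
    unit for each, collected in [Z2]. *)
Lemma needy_sum :
  S3 (fun a b c => k * ((needy a b c)%:Z * (excess2 a b)%:Z)) + Z2
  <= W + N ^+ 2 * H2.
Proof.
rewrite /Z2 /W /H2 -S2Z -!big_split; apply: ler_sum => a _.
rewrite -!big_split; apply: ler_sum => b _ /=.
case eab: (e a b); last first.
  rewrite !big1 ?addr0 // => c _; first by rewrite big1 // => d _; rewrite /cl4 /cl3 eab.
  by rewrite /cl3 eab.
case hab: (heavy2 a b); last first.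
  have -> : excess2 a b = 0%N by move: hab; rewrite /heavy2 /excess2; lia.
  have nd c : needy a b c = false by rewrite /needy hab.
  rewrite mulr0 !addr0 !big1 // => c _.
    by rewrite big1 // => d _; rewrite nd mul0r if_same.
  by rewrite nd !mul0r mulr0 if_same.
have := needy_cov hab.
have -> : \sum_(c | needy_triangle a b c) k * (excess2 a b)%:Z = \sum_c
    if cl3 a b c then k * ((needy a b c)%:Z * (excess2 a b)%:Z) else 0.
  rewrite big_mkcond; apply: eq_bigr => c _; rewrite /needy_triangle.
  by case: (cl3 a b c); case: (needy a b c); rewrite //= ?mul1r ?mul0r ?mulr0.
have -> : \sum_(c | needy_triangle a b c) cov a b c = \sum_c \sum_d
    if cl4 a b c d then (needy a b c)%:Z * share a b c d else 0.
  rewrite big_mkcond; apply: eq_bigr => c _; rewrite /needy_triangle /cov /cl4.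
  case: (cl3 a b c); case: (needy a b c) => /=.
  - by apply: eq_bigr => d _; rewrite mul1r.
  - by rewrite big1 // => d _; rewrite mul0r if_same.
  - by rewrite big1.
  - by rewrite big1.
by rewrite -lezD1.
Qed.

(** Twice the sum of [slack3_needy] leaves six times the demand of the needy triangles, which six
    times [needy_sum] together with [W_le] pays for. *)
Lemma heavy_deficit : 2 * k * H3 + 2 * Z3 + 6 * Z2 <= A + 6 * N ^+ 2 * H2 + 2 * N * B.
Proof.
have W6 := W_le; have NS := needy_sum.
pose F a b c := k * ((needy a b c)%:Z * (excess2 a b)%:Z).
have B1 : k * H3 + Z3 <= N * B + 3 * S3 F.
  have -> : 3 * S3 F = S3 F + S3 (fun a b c => F a c b) + S3 (fun a b c => F b c a).
    by rewrite (S3_132 es F) (S3_231 F); ring.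
  rewrite /H3 /B -!S3Z -!S3D; apply: le_S3 => a b c _.
  by have := slack3_needy a b c; rewrite /F !PoszD !PoszM; lra.
rewrite -/F in NS.
move: W6 NS B1; set z := S3 F; set N2 := N ^+ 2 * H2.
have -> : 6 * N ^+ 2 * H2 = 6 * N2 by rewrite /N2; ring.
by lra.
Qed.

(** * Lower bounds for triangles and 4-cliques, and the case of equality *)

Lemma S2_ge0 F : (forall a b, e a b -> 0 <= F a b) -> 0 <= S2 F.
Proof. by move=> F0; do 2! [apply: sumr_ge0 => ? _]; case: ifP => // /F0. Qed.

Lemma S3_ge0 F : (forall a b c, cl3 a b c -> 0 <= F a b c) -> 0 <= S3 F.
Proof. by move=> F0; do 3! [apply: sumr_ge0 => ? _]; case: ifP => // /F0. Qed.

Lemma S4_ge0 F : (forall a b c d, cl4 a b c d -> 0 <= F a b c d) -> 0 <= S4 F.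
Proof. by move=> F0; do 4! [apply: sumr_ge0 => ? _]; case: ifP => // /F0. Qed.

Lemma S2_eq0 F : (forall a b, e a b -> 0 <= F a b) -> S2 F = 0 ->
  forall a b, e a b -> F a b = 0.
Proof.
move=> F0 S0 a b eab.
have T0 x y : 0 <= if e x y then F x y else 0 by case: ifP => // /F0.
have := psumr_eq0P (fun x _ => sumr_ge0 _ (fun y _ => T0 x y)) S0 (i := a) isT.
by move/(psumr_eq0P (fun y _ => T0 a y))/(_ b isT); rewrite eab.
Qed.

Lemma S3_eq0 F : (forall a b c, cl3 a b c -> 0 <= F a b c) -> S3 F = 0 ->
  forall a b c, cl3 a b c -> F a b c = 0.
Proof.
move=> F0 S0 a b c abc.
pose G x y z := if cl3 x y z then F x y z else 0.
have G0 x y z : 0 <= G x y z by rewrite /G; case: ifP => // /F0.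
have := psumr_eq0P (fun x _ => sumr_ge0 _ (fun y _ =>
          sumr_ge0 _ (fun z _ => G0 x y z))) S0 (i := a) isT.
move/(psumr_eq0P (fun y _ => sumr_ge0 _ (fun z _ => G0 a y z)))/(_ b isT).
by move/(psumr_eq0P (fun z _ => G0 a b z))/(_ c isT); rewrite /G abc.
Qed.

Lemma S4_eq0 F : (forall a b c d, cl4 a b c d -> 0 <= F a b c d) -> S4 F = 0 ->
  forall a b c d, cl4 a b c d -> F a b c d = 0.
Proof.
move=> F0 S0 a b c d abcd.
pose G x y z t := if cl4 x y z t then F x y z t else 0.
have G0 x y z t : 0 <= G x y z t by rewrite /G; case: ifP => // /F0.
have := psumr_eq0P (fun x _ => sumr_ge0 _ (fun y _ => sumr_ge0 _ (fun z _ =>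
          sumr_ge0 _ (fun t _ => G0 x y z t)))) S0 (i := a) isT.
move/(psumr_eq0P (fun y _ => sumr_ge0 _ (fun z _ =>
  sumr_ge0 _ (fun t _ => G0 a y z t))))/(_ b isT).
move/(psumr_eq0P (fun z _ => sumr_ge0 _ (fun t _ => G0 a b z t)))/(_ c isT).
by move/(psumr_eq0P (fun t _ => G0 a b c t))/(_ d isT); rewrite /G abcd.
Qed.

Lemma X2_deg : X2 = \sum_a (D1 a)%:Z.
Proof. by rewrite /X2 (S2_deg e (fun=> 1)); apply: eq_bigr => a _; rewrite mul1r. Qed.

Lemma sum_n_const (x : int) : \sum_(a : V) x = n%:Z * x.
Proof. by rewrite sumr_const cardV -mulr_natl natz. Qed.

Lemma X2_ge : n%:Z * (n%:Z - q%:Z) <= X2.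
Proof.
rewrite X2_deg -sum_n_const; apply: ler_sum => a _.
by have := hdeg a; lia.
Qed.

Let term_A2 a b c : 0 <= ((trunc3 a b c)%:Z - g) * (q%:Z - (trunc3 a b c)%:Z).
Proof.
have := codeg3_lower a b c.
by rewrite /trunc3 => ?; rewrite mulr_ge0 //; lia.
Qed.

Let term_B2 a b : 0 <= ((trunc2 a b)%:Z - N) * (2 * q%:Z - (trunc2 a b)%:Z).
Proof.
have := codeg2_bounds a b.
by rewrite /trunc2 => ?; rewrite mulr_ge0 //; lia.
Qed.

Lemma nonneg_terms :
  [/\ 0 <= H3, 0 <= A, 0 <= B, 0 <= A2 & 0 <= B2]
  /\ 0 <= Z2 /\ 0 <= Z3.
Proof.
split; [split|split].
- by apply: S3_ge0.
- by apply: S4_ge0 => *; apply: slack4_ge0.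
- by apply: S3_ge0 => *; apply: slack3_ge0.
- by apply: S3_ge0 => *; apply: term_A2.
- by apply: S2_ge0 => *; apply: term_B2.
- by apply: S2_ge0.
- by apply: S3_ge0.
Qed.

(** The terms in [X2], [Z2], [Z3] and [A2] are kept because equality in the triangle bound must make
    each of them vanish. *)
Lemma X3_excess :
  2 * n%:Z * (n%:Z - q%:Z) * (X3 - 6 * q%:Z * N ^+ 2) >=
  12 * q%:Z * N ^+ 2 * (X2 - n%:Z * (n%:Z - q%:Z)) + (2 * Z3 + 6 * Z2)
    + 4 * A2.
Proof.
have [[_ A0 B0 _ B20] _] := nonneg_terms; have D := heavy_deficit.
rewrite [leRHS]mulrBr main_identity.
have : 0 <= 6 * N * B2 by rewrite !mulr_ge0 //; lia.
by lia.
Qed.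

Lemma K3_lower : 6 * q%:Z * N ^+ 2 <= X3.
Proof.
have [[_ A0 B0 A20 B20] [Z20 Z30]] := nonneg_terms; have E := X3_excess.
have c0 : 0 < 2 * n%:Z * (n%:Z - q%:Z) by rewrite !mulr_gt0 //; lia.
rewrite -subr_ge0 -(pmulr_rge0 _ c0).
have : 0 <= 12 * q%:Z * N ^+ 2 * (X2 - n%:Z * (n%:Z - q%:Z)).
  by rewrite mulr_ge0 ?subr_ge0 ?X2_ge // mulr_ge0 ?sqr_ge0 //; lia.
by lia.
Qed.

(** Bounds the surplus of 4-cliques below by a positive multiple of the surplus of triangles, so
    both the lower bound and the analysis of equality for 4-cliques reduce to triangles. *)
Lemma K4_excess : 4 * q%:Z * g * (X3 - 6 * q%:Z * N ^+ 2) <=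
  2 * N * (X4 - 12 * q%:Z ^+ 2 * N * g).
Proof.
have [[H0 A0 _ A20 _] _] := nonneg_terms; have E := K4_identity.
have : 0 <= 4 * g * H3 by rewrite !mulr_ge0 //; lia.
have -> : 2 * N * (X4 - 12 * q%:Z ^+ 2 * N * g)
  = (2 * n%:Z - 4 * q%:Z) * X4 - 4 * q%:Z * g * (6 * q%:Z * N ^+ 2) by ring.
by rewrite E mulrBr; lia.
Qed.

Lemma K4_lower : 12 * q%:Z ^+ 2 * N * g <= X4.
Proof.
have c0 : 0 < 2 * N by lia.
rewrite -subr_ge0 -(pmulr_rge0 _ c0); apply: le_trans K4_excess.
by rewrite mulr_ge0 ?subr_ge0 ?K3_lower // mulr_ge0 //; lia.
Qed.

Lemma K4_tight_K3 : X4 = 12 * q%:Z ^+ 2 * N * g -> X3 = 6 * q%:Z * N ^+ 2.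
Proof.
move=> E; have := K4_excess; rewrite E subrr mulr0.
have c0 : 0 < 4 * q%:Z * g by rewrite mulr_gt0 //; lia.
rewrite pmulr_rle0 // subr_le0 => le3.
by apply/eqP; rewrite eq_le le3 K3_lower.
Qed.

(** Every nonnegative term vanishes: the one in [X2] gives regularity, [Z2] and [Z3] exclude heavy
    cliques, [A2] confines triangle codegrees to two values, and [A] makes [slack4] zero, which with
    [k4_bounds] excludes 5-cliques. *)
Lemma K3_tight : X3 = 6 * q%:Z * N ^+ 2 ->
  [/\ forall a, D1 a = (n - q)%N,
      forall a b c, cl3 a b c -> D3 a b c = q \/ D3 a b c = (n - 3 * q)%N &
      forall a b c d, cl4 a b c d ->
        (D3 a b c + D3 a b d + D3 a c d + D3 b c d + 4 * q = 2 * n)%N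
        /\ D4 a b c d = 0%N].
Proof.
move=> E; have [[H0 A0 B0 A20 B20] [Z20 Z30]] := nonneg_terms.
have := X3_excess; rewrite E subrr mulr0.
have c0 : 0 < 12 * q%:Z * N ^+ 2 by rewrite mulr_gt0 ?exprn_gt0 //; lia.
have X20 : 0 <= 12 * q%:Z * N ^+ 2 * (X2 - n%:Z * (n%:Z - q%:Z)).
  by rewrite mulr_ge0 ?subr_ge0 ?X2_ge // ltW.
move=> le0.
have {X20} X2E : X2 = n%:Z * (n%:Z - q%:Z).
  apply/eqP; rewrite -subr_eq0.
  have /eqP : 12 * q%:Z * N ^+ 2 * (X2 - n%:Z * (n%:Z - q%:Z)) = 0 by lia.
  by rewrite mulf_eq0 gt_eqF.
have Z2E : Z2 = 0 by lia.
have Z3E : Z3 = 0 by lia.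
have A2E : A2 = 0 by lia.
have nh2 a b : e a b -> ~~ heavy2 a b.
  by move=> eab; have := S2_eq0 (fun _ _ _ => le0z_nat _) Z2E eab; case: (heavy2 a b).
have nh3 a b c : cl3 a b c -> (D3 a b c <= q)%N.
  move=> abc; have := S3_eq0 (fun _ _ _ _ => le0z_nat _) Z3E abc.
  have [/nh2 h1 /nh2 h2 /nh2 h3] := and3P abc.
  by rewrite !negb_or h1 h2 h3 andbT /heavy3; lia.
have H3E : H3 = 0.
  rewrite /H3 (_ : S3 _ = S3 (fun _ _ _ => 0)).
    by rewrite S3_const mul0r.
  by apply: eq_S3 => a b c /nh3; rewrite /excess3; lia.
have H2E : H2 = 0.
  rewrite /H2 (_ : S2 _ = S2 (fun _ _ => 0)).
    by rewrite S2_const mul0r.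
  by apply: eq_S2 => a b /nh2; rewrite /excess2 /heavy2; lia.
(* [X3_excess] has discarded [A], so it is recovered from the exact identity, now that the excess
   sums are zero. *)
have AE : A = 0.
  have := main_identity; rewrite X2E E A2E H3E H2E.
  have NB0 : 0 <= 2 * N * B by rewrite !mulr_ge0 //; lia.
  have NB20 : 0 <= 6 * N * B2 by rewrite !mulr_ge0 //; lia.
  by lia.
split.
- have S0 : \sum_a ((D1 a)%:Z - (n%:Z - q%:Z)) = 0.
    by rewrite sumrB -X2_deg sum_n_const X2E subrr.
  move=> a; have := psumr_eq0P _ S0 (i := a) isT.
  have T x : true -> 0 <= (D1 x)%:Z - (n%:Z - q%:Z) by have := hdeg x; lia.
  by move/(_ T); lia.
- move=> a b c abc; have := S3_eq0 (fun a b c _ => term_A2 a b c) A2E abc.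
  have := codeg3_lower a b c.
  rewrite /trunc3 (minn_idPl (nh3 _ _ _ abc)) => lo /eqP.
  by rewrite mulf_eq0 => /orP[]/eqP; lia.
- move=> a b c d abcd; have := S4_eq0 (fun a b c d _ => slack4_ge0 a b c d) AE abcd.
  have [T _ _] := k4_bounds a b c d.
  have abc : cl3 a b c by case/andP: abcd.
  have abd : cl3 a b d by rewrite -(cl4_1243 es) in abcd; case/andP: abcd.
  have acd : cl3 a c d.
    by rewrite -(cl4_1324 es) -(cl4_1243 es) in abcd; case/andP: abcd.
  have bcd : cl3 b c d.
    rewrite -(cl4_2134 es) -(cl4_1324 es) -(cl4_1243 es) in abcd.
    by case/andP: abcd.
  have := nh3 _ _ _ abc; have := nh3 _ _ _ abd; have := nh3 _ _ _ acd.
  have := nh3 _ _ _ bcd; rewrite /slack4 /trunc3.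
  by lia.
Qed.

End HeavyCliques.

(** The sum 2n - 4q is that of two values q and two values n - 3q. For n < 4q these differ, so
    exactly two are q; for n = 4q all four are. *)
Lemma two_equal (n q x y z t : nat) :
  x = q \/ x = (n - 3 * q)%N -> y = q \/ y = (n - 3 * q)%N ->
  z = q \/ z = (n - 3 * q)%N -> t = q \/ t = (n - 3 * q)%N ->
  (3 * q < n)%N -> (n <= 4 * q)%N -> (x + y + z + t + 4 * q = 2 * n)%N ->
  x = q /\ y = q \/ x = q /\ z = q \/ x = q /\ t = q \/
  y = q /\ z = q \/ y = q /\ t = q \/ z = q /\ t = q.
Proof. by case=> ->; case=> ->; case=> ->; case=> ->; lia. Qed.

(** * Structure of the graphs attaining equality *)

Section TightStructure.

Variables (V : finType) (e : rel V) (n q : nat).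
Hypotheses (es : symmetric e) (cardV : #|V| = n).

Definition part (I : {set V}) := forall v, v \in I -> forall u, e v u = (u \notin I).

Lemma codeg1_card a : codeg1 e a = #|[set u | e a u]|.
Proof. by rewrite /codeg1 -big_mkcond sum1dep_card. Qed.

Lemma codeg2_card a b : codeg2 e a b = #|[set u | e a u && e b u]|.
Proof. by rewrite /codeg2 -big_mkcond sum1dep_card. Qed.

Lemma codeg3_card a b c : codeg3 e a b c = #|[set u | [&& e a u, e b u & e c u]]|.
Proof. by rewrite /codeg3 -big_mkcond sum1dep_card. Qed.

Lemma codeg4_card a b c d :
  codeg4 e a b c d = #|[set u | [&& e a u, e b u, e c u & e d u]]|.
Proof. by rewrite /codeg4 -big_mkcond sum1dep_card. Qed.

Hypothesis D1E : forall a, codeg1 e a = (n - q)%N.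
Hypothesis qn : (q <= n)%N.
Hypothesis D4E : forall a b c d, cl4 e a b c d -> codeg4 e a b c d = 0%N.

(** As there is no 5-clique, a vertex of the common neighbourhood has all its neighbours outside it;
    having n - q neighbours, it is adjacent to everything outside. *)
Lemma common_nbrs_part a b c : cl3 e a b c -> codeg3 e a b c = q ->
  exists2 I : {set V}, part I & #|I| = q /\ forall v, cl4 e a b c v -> v \in I.
Proof.
move=> abc; rewrite codeg3_card; set I := [set u | _] => Iq.
exists I; last by split=> // v /andP[_]; rewrite inE.
move=> v; rewrite inE => abcv u.
have sub : I \subset ~: [set u | e v u].
  apply/subsetP => w; rewrite !inE => /and3P[aw bw cw]; apply/negP => vw.
  have := @D4E a b c v; rewrite /cl4 abc abcv => /(_ isT) /eqP.
  rewrite codeg4_card cards_eq0 => /eqP/setP/(_ w).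
  by rewrite !inE aw bw cw vw.
have := D1E v; rewrite codeg1_card => dv.
have /setP/(_ u) : I = ~: [set u | e v u].
  by apply/eqP; rewrite eqEcard sub cardsCs setCK dv cardV Iq; lia.
by rewrite !inE => ->; rewrite negbK.
Qed.

Hypothesis q3n : (3 * q < n)%N.
Hypothesis n4q : (n <= 4 * q)%N.
Hypothesis D3E : forall a b c, cl3 e a b c ->
  codeg3 e a b c = q \/ codeg3 e a b c = (n - 3 * q)%N.
Hypothesis D3sum : forall a b c d, cl4 e a b c d ->
  (codeg3 e a b c + codeg3 e a b d + codeg3 e a c d + codeg3 e b c d + 4 * q = 2 * n)%N.

Lemma exists_cl4 : exists a b c d, cl4 e a b c d.
Proof.
have hdeg a : (n <= q + codeg1 e a)%N by rewrite D1E; lia.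
have /card_gt0P[a _] : (0 < #|V|)%N by lia.
have : (0 < #|[set u | e a u]|)%N by rewrite -codeg1_card D1E; lia.
case/card_gt0P => b; rewrite inE => ab.
have : (0 < #|[set u | e a u && e b u]|)%N.
  by rewrite -codeg2_card; have := codeg2_bounds cardV hdeg q3n n4q a b; lia.
case/card_gt0P => c; rewrite inE => abc.
have : (0 < #|[set u | [&& e a u, e b u & e c u]]|)%N.
  by rewrite -codeg3_card; have := codeg3_lower cardV hdeg q3n n4q a b c; lia.
case/card_gt0P => d; rewrite inE => abcd.
by exists a, b, c, d; rewrite /cl4 /cl3 ab abc abcd.
Qed.

Definition in_part x := exists2 I : {set V}, part I & #|I| = q /\ x \in I.

(** In a 4-clique two triangles have codegree q, and the vertex opposite each of them lies in the
    common neighbourhood of that triangle. *)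
Lemma two_in_parts : exists x y, [/\ e x y, in_part x & in_part y].
Proof.
have [a [b [c [d abcd]]]] := exists_cl4.
have mk x y z t : cl4 e x y z t -> codeg3 e x y z = q -> in_part t.
  move=> xyzt Dq; have [xyz _] := andP xyzt.
  by have [I ? [? H]] := common_nbrs_part xyz Dq; exists I => //; split; auto.
have abdc : cl4 e a b d c by rewrite (cl4_1243 es).
have acdb : cl4 e a c d b by rewrite (cl4_1243 es) (cl4_1324 es).
have bcda : cl4 e b c d a by rewrite (cl4_1243 es) (cl4_1324 es) (cl4_2134 es).
have [Pd Pc Pb Pa] := And4 (mk _ _ _ _ abcd) (mk _ _ _ _ abdc)
                           (mk _ _ _ _ acdb) (mk _ _ _ _ bcda).
have [/and3P[ab ac bc] /and3P[ad bd cd]] := andP abcd.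
have := two_equal (D3E (proj1 (andP abcd))) (D3E (proj1 (andP abdc)))
  (D3E (proj1 (andP acdb))) (D3E (proj1 (andP bcda))) q3n n4q (D3sum abcd).
case=> [[/Pd ? /Pc ?]|[[/Pd ? /Pb ?]|[[/Pd ? /Pa ?]|[[/Pc ? /Pb ?]|
       [[/Pc ? /Pa ?]|[/Pb ? /Pa ?]]]]]].
- by exists c, d.
- by exists b, d.
- by exists a, d.
- by exists b, c.
- by exists a, c.
- by exists a, b.
Qed.

Lemma tight_parts : exists I1 I2 : {set V},
  [/\ part I1, part I2, #|I1| = q, #|I2| = q & [disjoint I1 & I2]] /\
  forall a b c, cl3 e a b c -> [|| a \in I1 :|: I2, b \in I1 :|: I2 | c \in I1 :|: I2].
Proof.
have [x [y [xy [I P1 [q1 xI]] [J P2 [q2 yJ]]]]] := two_in_parts.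
exists I, J; split; first split=> //.
  (* A common vertex [v] is not adjacent to [y], which puts [y] into [I], against the adjacency of
     [x] and [y]. *)
  rewrite -setI_eq0; apply/set0Pn => -[v]; rewrite inE => /andP[vI vJ].
  have := P1 v vI y; rewrite (P2 v vJ) yJ /=.
  by rewrite -(P1 x xI) xy.
move=> a b c abc; rewrite !inE; apply/negPn/negP; rewrite !negb_or.
case/and3P=> /andP[aI aJ] /andP[bI bJ] /andP[cI cJ].
(* A triangle avoiding both parts would form a 5-clique with [x] and [y]. *)
have abcx : cl4 e a b c x.
  by rewrite /cl4 abc !(es _ x) !(P1 x xI) aI bI cI.
have := D4E abcx; rewrite codeg4_card => /eqP; rewrite cards_eq0 => /eqP/setP/(_ y).
by rewrite !inE !(es _ y) !(P2 y yJ) aJ bJ cJ -(P2 y yJ) es xy.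
Qed.

End TightStructure.

(** * Counting cliques as sets *)

Section CliqueCounts.

Variables (n : nat) (E : sgraph n).
Implicit Types (X S I : {set 'I_n}).

Definition cliques_in r X :=
  [set S : {set 'I_n} | (S \subset X) && (#|S| == r) && clique E S].
Definition kin r X := #|cliques_in r X|.
Definition nbr a : {set 'I_n} := [set u | adj E a u].

Lemma adj_sym : symmetric (adj E).
Proof. by move=> x y; rewrite /adj eq_sym setUC. Qed.

Lemma adj_irr x : adj E x x = false.
Proof. by rewrite /adj eqxx. Qed.

Lemma kr_kin r : kr E r = kin r setT.
Proof. by apply: eq_card => S; rewrite !inE subsetT. Qed.

Lemma tri_in_kin X : tri_in E X = kin 3 X.
Proof. by []. Qed.

Lemma cliqueP S :
  reflect (forall x y, x \in S -> y \in S -> x != y -> adj E x y) (clique E S).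
Proof.
apply: (iffP forall_inP) => [H x y xS yS|H x xS].
  by have /forall_inP/(_ y yS)/implyP := H x xS.
by apply/forall_inP => y yS; apply/implyP; apply: H.
Qed.

Lemma clique_sub S S' : S' \subset S -> clique E S -> clique E S'.
Proof.
move=> /subsetP sub /cliqueP cS; apply/cliqueP => x y xS yS.
by apply: cS; apply: sub.
Qed.

Lemma cliques_through r X a : a \in X ->
  #|[set S in cliques_in r.+1 X | a \in S]| = kin r (X :&: nbr a).
Proof.
move=> aX; rewrite -[RHS](@card_in_imset _ _ (setU [set a])).
  apply: eq_card => S; apply/idP/imsetP; rewrite !inE.
    case/andP => /andP[/andP[SX Sr] cS] aS; exists (S :\ a); last by rewrite setD1K.
    rewrite !inE (clique_sub _ cS) ?subsetDl // andbT.
    rewrite (cardsD1 a) aS in Sr; rewrite -eqSS Sr andbT.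
    apply/subsetP => x; rewrite !inE => /andP[xa xS].
    by rewrite (subsetP SX) // (cliqueP _ cS) // eq_sym.
  case=> S'; rewrite !inE => /andP[/andP[S'X /eqP S'r] cS'] ->.
  have aS' : a \notin S'.
    by apply/negP => /(subsetP S'X); rewrite !inE adj_irr andbF.
  rewrite setU11 cardsU1 aS' S'r eqxx !andbT subUset sub1set aX.
  rewrite (subset_trans S'X) ?subsetIl //=.
  apply/cliqueP => x y; rewrite !inE => /orP[/eqP->|xS] /orP[/eqP->|yS].
  - by rewrite eqxx.
  - by have := subsetP S'X _ yS; rewrite !inE => /andP[].
  - by have := subsetP S'X _ xS; rewrite !inE adj_sym => /andP[].
  - exact: (cliqueP _ cS').
move=> S S'; rewrite !inE => /andP[/andP[SX _] _] /andP[/andP[S'X _] _] eSS.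
have nS (T : {set _}) : T \subset X :&: nbr a -> a \notin T.
  by move=> TX; apply/negP => /(subsetP TX); rewrite !inE adj_irr andbF.
by rewrite -(setU1K (nS _ SX)) eSS setU1K ?nS.
Qed.

Lemma sum_through (P : pred 'I_n) (K : {set {set 'I_n}}) :
  (\sum_(a | P a) #|[set S in K | a \in S]| =
   \sum_(S in K) #|[set a in S | P a]|)%N.
Proof.
under eq_bigr => a _ do rewrite -sum1dep_card big_mkcondr /=.
under [RHS]eq_bigr => S _ do rewrite -sum1dep_card.
rewrite exchange_big /=; apply: eq_bigr => S _.
by rewrite -big_mkcondr; apply: eq_bigl => a; rewrite andbC.
Qed.

Lemma kin_succ r X :
  (r.+1 * kin r.+1 X = \sum_(a in X) kin r (X :&: nbr a))%N.
Proof.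
under eq_bigr => a aX do rewrite -cliques_through //.
rewrite sum_through (eq_bigr (fun=> r.+1)) ?sum_nat_const ?(mulnC _ r.+1) //.
move=> S; rewrite !inE => /andP[/andP[SX /eqP Sr] _]; rewrite -Sr.
apply: eq_card => x; rewrite !inE.
by case xS: (x \in S) => //=; rewrite (subsetP SX).
Qed.

Lemma kin0 X : kin 0 X = 1%N.
Proof.
rewrite /kin (_ : cliques_in 0 X = [set set0]) ?cards1 //.
apply/setP => S; rewrite !inE cards_eq0; case: eqP => [->|]; rewrite ?andbF //.
by rewrite sub0set; apply/cliqueP => x y; rewrite inE.
Qed.

Lemma kin1 X : kin 1 X = #|X|.
Proof.
by rewrite -[LHS]mul1n kin_succ (eq_bigr (fun=> 1%N)) ?sum1_card // => a _; rewrite kin0.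
Qed.

(** A clique has at most one vertex in the independent set [I], and each vertex of [I] extends every
    clique of the rest of [X]. *)
Lemma kin_part r X I : I \subset X -> part (adj E) I ->
  kin r.+1 X = (kin r.+1 (X :\: I) + #|I| * kin r (X :\: I))%N.
Proof.
move=> IX PI; rewrite {1}/kin -sum1_card.
rewrite (bigID (fun S => S \subset X :\: I)) /=; congr addn.
  rewrite sum1dep_card; apply: eq_card => S; rewrite !inE.
  case SXI: (S \subset X :\: I); rewrite ?andbF //= andbT.
  by rewrite (subset_trans SXI) ?subsetDl.
have -> : (#|I| * kin r (X :\: I) = \sum_(a in I) kin r (X :&: nbr a))%N.
  rewrite -sum_nat_const; apply: eq_bigr => a aI; congr (kin r _).
  by apply/setP => x; rewrite !inE (PI a aI) andbC.
under [RHS]eq_bigr => a aI do rewrite -(cliques_through r (subsetP IX a aI)).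
rewrite sum_through big_mkcondr /=; apply: eq_bigr => S.
rewrite inE => /andP[/andP[SX _] /cliqueP cS].
have le1 : (#|[set a in S | a \in I]| <= 1)%N.
  apply/card_le1_eqP => x y; rewrite !inE => /andP[xS xI] /andP[yS yI].
  apply/eqP; apply/negPn/negP => xy.
  by have := cS y x yS xS xy; rewrite (PI y yI) xI.
have : (S \subset X :\: I) = (#|[set a in S | a \in I]| == 0%N).
  rewrite cards_eq0 subsetD SX /= -setI_eq0.
  suff -> : S :&: I = [set a in S | a \in I] by [].
  by apply/setP => x; rewrite !inE.
by move=> ->; move: le1; move: #|[set _ in _ | _]| => [|[]].
Qed.

Lemma kin_succ_setT r : (r.+1 * kin r.+1 setT = \sum_a kin r (nbr a))%N.
Proof. by rewrite kin_succ; apply: eq_big => a; rewrite ?inE ?setTI. Qed.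

Lemma X3_kin : S3 (adj E) (fun _ _ _ => 1) = (6 * kin 3 setT)%N%:Z.
Proof.
have -> : (6 * kin 3 setT = 2 * (3 * kin 3 setT))%N by rewrite mulnA.
rewrite kin_succ_setT big_distrr /= natz_sum (S3_S2 _ (fun _ _ => 1)).
apply: eq_bigr => a _; rewrite kin_succ natz_sum [RHS]big_mkcond /=.
apply: eq_bigr => b _; rewrite inE; case: ifP => // _.
rewrite kin1 mul1r codeg2_card; congr Posz; apply: eq_card => x.
by rewrite !inE.
Qed.

Lemma X4_kin : S4 (adj E) (fun _ _ _ _ => 1) = (24 * kin 4 setT)%N%:Z.
Proof.
have -> : (24 * kin 4 setT = 6 * (4 * kin 4 setT))%N by rewrite mulnA.
rewrite kin_succ_setT big_distrr /= natz_sum (S4_S3 _ (fun _ _ _ => 1)).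
apply: eq_bigr => a _.
have -> : (6 * kin 3 (nbr a) = 2 * (3 * kin 3 (nbr a)))%N by rewrite mulnA.
rewrite kin_succ big_distrr /= natz_sum [RHS]big_mkcond /=.
apply: eq_bigr => b _; rewrite inE kin_succ natz_sum.
case ab: (adj E a b); last by rewrite big1 // => c _; rewrite /cl3 ab.
rewrite [RHS]big_mkcond /=; apply: eq_bigr => c _; rewrite !inE /cl3 ab /=.
case: ifP => // _; rewrite kin1 mul1r codeg3_card; congr Posz; apply: eq_card => x.
by rewrite !inE andbA.
Qed.

End CliqueCounts.

Section Degrees.

Variables (n : nat) (E : sgraph n).

Lemma deg_D1 v : deg E v = codeg1 (adj E) v.
Proof. by rewrite codeg1_card. Qed.

Lemma handshake : (\sum_v deg E v = 2 * kin E 2 setT)%N.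
Proof.
rewrite kin_succ_setT; apply: eq_bigr => v _.
by rewrite kin1.
Qed.

End Degrees.

(** * Pulling a graph back along an injection *)

Section Transport.

Lemma eq_kin n (E E' : sgraph n) r X : adj E =2 adj E' -> kin E r X = kin E' r X.
Proof.
move=> eA; apply: eq_card => S; rewrite !inE; congr (_ && _).
by apply: eq_forallb_in => x _; apply: eq_forallb_in => y _; rewrite eA.
Qed.

Variables (m n : nat) (f : 'I_m -> 'I_n) (E : sgraph n).
Hypothesis finj : injective f.

Definition pullback : sgraph m := [set s : {set 'I_m} | f @: s \in E].

Lemma simple_pullback : simple E -> simple pullback.
Proof.
move=> /forall_inP sE; apply/forall_inP => s; rewrite inE => /sE.
by rewrite card_imset.
Qed.

Lemma adj_pullback x y : adj pullback x y = adj E (f x) (f y).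
Proof. by rewrite /adj (inj_eq finj) inE imsetU !imset_set1. Qed.

Lemma deg_pullback x :
  deg pullback x = #|[set u in f @: setT | adj E (f x) u]|.
Proof.
rewrite /deg -(card_imset _ finj); apply: eq_card => u; rewrite inE.
apply/imsetP/andP.
  by case=> y; rewrite inE adj_pullback => xy ->; rewrite imset_f.
by case=> /imsetP[y _ ->] xy; exists y; rewrite // inE adj_pullback.
Qed.

Lemma kr_pullback r : kr pullback r = kin E r (f @: setT).
Proof.
have iinj := imset_inj finj.
rewrite /kr -(card_imset _ iinj); apply: eq_card => S.
rewrite inE; apply/imsetP/andP.
  case=> s; rewrite inE => /andP[sr /cliqueP cs] ->; split.
    by rewrite imsetS ?subsetT //= card_imset.
  apply/cliqueP => x y /imsetP[x' xs ->] /imsetP[y' ys ->].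
  by rewrite (inj_eq finj) -adj_pullback; apply: cs.
case=> /andP[SX Sr] /cliqueP cS.
have SE : S = f @: (f @^-1: S).
  apply/setP => x; apply/idP/imsetP => [xS|[y]]; last by rewrite inE => ? ->.
  by have /imsetP[y _ ye] := subsetP SX x xS; exists y; rewrite // inE -ye.
exists (f @^-1: S) => //; rewrite inE -(card_imset _ finj) -SE Sr /=.
apply/cliqueP => x y; rewrite !inE => xS yS xy.
by rewrite adj_pullback cS // (inj_eq finj).
Qed.

End Transport.

(** * The graph of a symmetric relation *)

Section FromRelation.

Variables (n : nat) (R : rel 'I_n).
Hypothesis Rs : symmetric R.

Definition graph_of : sgraph n :=
  [set s | [exists x, exists y, [&& x != y, R x y & s == [set x; y]]]].

Lemma simple_graph_of : simple graph_of.
Proof.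
apply/forall_inP => s; rewrite inE => /existsP[x /existsP[y /and3P[xy _ /eqP->]]].
by rewrite cards2 xy.
Qed.

Lemma adj_graph_of x y : adj graph_of x y = (x != y) && R x y.
Proof.
rewrite /adj; case: eqVneq => //= xy; rewrite inE.
apply/existsP/idP => [[a /existsP[b /and3P[ab Rab /eqP eab]]]|Rxy]; last first.
  by exists x; apply/existsP; exists y; rewrite xy Rxy /=.
have /set2P[xE|xE] : x \in [set a; b] by rewrite -eab set21.
all: have /set2P[yE|yE] : y \in [set a; b] by rewrite -eab set22.
all: move: xy; rewrite xE yE ?eqxx // => _.
by rewrite Rs.
Qed.

End FromRelation.

(** * Existence of regular graphs *)

Section Circulant.

Lemma card_ord_interval m a b : (b <= m)%N ->
  #|[set i : 'I_m | (a <= i < b)%N]| = (b - a)%N.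
Proof.
move=> bm; have bm' i : (i < b - a -> a + i < m)%N by lia.
pose f (i : 'I_(b - a)) := Ordinal (bm' i (ltn_ord i)).
have finj : injective f by move=> i j /(congr1 val) /= /addnI /val_inj.
rewrite -[RHS]card_ord -cardsT -(card_imset _ finj); apply: eq_card => i.
rewrite !inE; apply/idP/imsetP => [iab|[j _ ->] /=]; last by have := ltn_ord j; lia.
have ib : (i - a < b - a)%N by lia.
by exists (Ordinal ib) => //; apply: val_inj => /=; lia.
Qed.

(* Cayley graph of Z/m whose connection set consists of the residues at cyclic
   distance at most k/2 from 0, together with m/2 when k is odd. *)
Lemma exists_regular_graph m k : (k < m)%N -> ~~ odd (m * k) ->
  exists2 H : sgraph m, simple H & forall v, deg H v = k.
Proof.
case: m => // m km even_mk.
pose h := k./2.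
pose A := [set i : 'I_m.+1 | (1 <= i < h.+1)%N].
pose A' := [set i : 'I_m.+1 | (m.+1 - h <= i < m.+1)%N].
pose M := [set i : 'I_m.+1 | ((m.+1)./2 <= i < (m.+1)./2 + odd k)%N].
have kE : (k = h.*2 + odd k)%N by rewrite addnC odd_double_half.
have mE : odd k -> (m.+1 = (m.+1)./2.*2)%N.
  move=> ok; move: even_mk; rewrite oddM ok andbT => em.
  by rewrite -[LHS]odd_double_half (negbTE em).
pose S := A :|: A' :|: M.
have cA : #|A| = h by rewrite card_ord_interval; lia.
have cA' : #|A'| = h by rewrite card_ord_interval; lia.
have cM : #|M| = odd k by rewrite card_ord_interval; lia.
have d1 : A :&: A' = set0 by apply/setP => i; rewrite !inE; lia.
have d2 : (A :|: A') :&: M = set0 by apply/setP => i; rewrite !inE; lia.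
have cS : #|S| = k by rewrite cardsU d2 cards0 cardsU d1 cards0; lia.
have S0 : (0 : 'I_m.+1) \notin S by rewrite !inE /=; lia.
have opp_sub i : i \in S -> - i \in S.
  rewrite !inE /=; case: (posnP i) => [-> //|i0]; first by rewrite subn0 modnn.
  by rewrite modn_small; have := ltn_ord i; lia.
have SN i : (- i \in S) = (i \in S).
  by apply/idP/idP => /opp_sub //; rewrite opprK.
pose R (x y : 'I_m.+1) := y - x \in S.
have Rs : symmetric R by move=> x y; rewrite /R -opprB SN.
exists (graph_of R); first exact: simple_graph_of.
move=> v; rewrite /deg -cS -[RHS](card_imset _ (@addrI _ v)).
apply: eq_card => u; rewrite inE adj_graph_of //; apply/andP/imsetP.
  by case=> _ uS; exists (u - v); rewrite // addrC subrK.
case=> i iS ->; rewrite /R addrAC subrr add0r iS; split=> //.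
by rewrite eq_sym -subr_eq0 addrAC subrr add0r; apply: contraNneq S0 => <-.
Qed.

End Circulant.

(** * The minimum [krmin] and its attainment *)

Section MinimumCliqueNumber.

Variables n d r : nat.

Lemma big_minn_le (T : eqType) (s : seq T) (P : pred T) (F : T -> nat) x0 j :
  j \in s -> P j -> (\big[minn/x0]_(i <- s | P i) F i <= F j)%N.
Proof.
elim: s => //= i s IH; rewrite inE big_cons => /orP[/eqP<- ->|js Pj].
  by rewrite geq_minl.
by case: ifP => _; rewrite ?geq_min IH ?orbT.
Qed.

Lemma krmin_le (E : sgraph n) : simple E -> mindeg E d -> (krmin n d r <= kr E r)%N.
Proof.
by move=> sE dE; apply: big_minn_le; rewrite ?mem_index_enum // sE dE.
Qed.

Definition complete : sgraph n := graph_of (fun _ _ => true).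

Lemma adj_complete x y : adj complete x y = (x != y).
Proof. by rewrite adj_graph_of // andbT. Qed.

Lemma kr_complete : kr complete r = 'C(n, r).
Proof.
rewrite -[n in RHS](card_ord n) -card_draws; apply: eq_card => S; rewrite !inE.
case: eqP => //= _; apply/cliqueP => x y _ _; by rewrite adj_complete.
Qed.

Lemma deg_complete v : deg complete v = n.-1.
Proof.
rewrite /deg (_ : [set u | _] = [set~ v]) ?cardsC1 ?card_ord //.
by apply/setP => u; rewrite !inE adj_complete eq_sym.
Qed.

(** The start value of the minimum is attained by the complete graph, whose degrees may exceed [d].
    Hence the witness only has degrees at least [d], which is all that the lower bounds require. *)
Lemma krmin_attained : (d < n)%N -> exists2 E : sgraph n, simple E &
  (forall v, (d <= deg E v)%N) /\ kr E r = krmin n d r.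
Proof.
move=> dn; rewrite /krmin; elim/big_ind: _ => [|x y|E].
- exists complete; first exact: simple_graph_of.
  by rewrite kr_complete; split=> // v; rewrite deg_complete; lia.
- move=> [E1 s1 [d1 <-]] [E2 s2 [d2 <-]].
  by case: (leqP (kr E1 r) (kr E2 r)) => _; [exists E1|exists E2].
- by case/andP => sE /andP[_ /forallP dE]; exists E.
Qed.

End MinimumCliqueNumber.

(** * Graphs with the shape of the family *)

Section ThreePartStructure.

Variables n q : nat.
Hypotheses (q3n : (3 * q < n)%N) (n4q : (n <= 4 * q)%N).
Implicit Types (E : sgraph n) (I J : {set 'I_n}).

Definition core I J : {set 'I_n} := ~: (I :|: J).

(* The shape of a member of the family: [core I J], [I] and [J] are V_0, V_1 and V_2. *)
Definition three_parts E I J :=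
  [/\ part (adj E) I, part (adj E) J, #|I| = q, #|J| = q & [disjoint I & J]] /\
  forall v, v \in core I J -> #|[set u in core I J | adj E v u]| = (n - 3 * q)%N.

Lemma card_core E I J : three_parts E I J -> #|core I J| = (n - 2 * q)%N.
Proof.
case=> -[_ _ Iq Jq dIJ] _; rewrite cardsCs setCK card_ord cardsU Iq Jq.
by rewrite (disjoint_setI0 dIJ) cards0; lia.
Qed.

Lemma three_parts_kin E I J : three_parts E I J -> kin E 3 (core I J) = 0%N ->
  kr E 3 = (q * (n - 2 * q) ^ 2)%N /\
  (2 * kr E 4 = q ^ 2 * (n - 2 * q) * (n - 3 * q))%N.
Proof.
move=> TP K30; have cc := card_core TP; have [[PI PJ Iq Jq dIJ] reg] := TP.
have JT : J \subset setT :\: I.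
  by rewrite subsetD subsetT disjoint_sym.
have cE : (setT :\: I) :\: J = core I J by rewrite setDDl setTD.
(* Joining two independent sets of size q multiplies the clique polynomial of the core by (1 +
   qx)^2. *)
have step r : kin E r.+2 setT = (kin E r.+2 (core I J)
    + 2 * q * kin E r.+1 (core I J) + q ^ 2 * kin E r (core I J))%N.
  rewrite (kin_part _ (subsetT I) PI) !(kin_part _ JT PJ) cE Iq Jq; ring.
have K2 : (2 * kin E 2 (core I J) = (n - 2 * q) * (n - 3 * q))%N.
  rewrite kin_succ (eq_bigr (fun=> n - 3 * q)%N) ?sum_nat_const ?cc // => v vc.
  by rewrite kin1 -(reg v vc); apply: eq_card => u; rewrite !inE.
have K40 : kin E 4 (core I J) = 0%N.
  apply/eqP; rewrite cards_eq0 -subset0; apply/subsetP => S; rewrite !inE.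
  case/andP=> /andP[SX /eqP S4] cS.
  have /card_gt0P[x xS] : (0 < #|S|)%N by rewrite S4.
  have S3 : #|S :\ x| = 3%N by have := cardsD1 x S; rewrite xS S4; lia.
  have := K30; rewrite /kin => /eqP; rewrite cards_eq0 => /eqP/setP/(_ (S :\ x)).
  rewrite !inE S3 (clique_sub _ cS) ?subsetDl //.
  by rewrite (subset_trans _ SX) ?subsetDl.
rewrite !kr_kin !step K30 K40 kin1 cc; split; nia.
Qed.

Section MinimumDegree.

Variable E : sgraph n.
Hypothesis hdeg : forall v, (n - q <= deg E v)%N.

Let es := adj_sym E.
Let cardV : #|'I_n| = n := card_ord n.

Let hdegD v : (n <= q + codeg1 (adj E) v)%N.
Proof. by have := hdeg v; rewrite deg_D1; lia. Qed.

Lemma kr2_lower : (n * (n - q) <= 2 * kr E 2)%N.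
Proof.
rewrite kr_kin -handshake -[n in (n * _)%N](card_ord n) -sum_nat_const.
exact: leq_sum.
Qed.

Lemma kr3_lower : (q * (n - 2 * q) ^ 2 <= kr E 3)%N.
Proof.
have := K3_lower es cardV hdegD q3n n4q; rewrite X3_kin -kr_kin.
have -> : n%:Z - 2 * q%:Z = (n - 2 * q)%N by lia.
by move: (n - 2 * q)%N => N; lia.
Qed.

Lemma kr4_lower : (q ^ 2 * (n - 2 * q) * (n - 3 * q) <= 2 * kr E 4)%N.
Proof.
have := K4_lower es cardV hdegD q3n n4q; rewrite X4_kin -kr_kin.
have -> : n%:Z - 2 * q%:Z = (n - 2 * q)%N by lia.
have -> : n%:Z - 3 * q%:Z = (n - 3 * q)%N by lia.
by move: (n - 2 * q)%N (n - 3 * q)%N => N g; lia.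
Qed.

(** Tightness for 4-cliques implies tightness for triangles by [K4_tight_K3], so one structural
    argument serves both. *)
Lemma kr_tight : kr E 3 = (q * (n - 2 * q) ^ 2)%N \/
  (2 * kr E 4 = q ^ 2 * (n - 2 * q) * (n - 3 * q))%N ->
  exists I J, three_parts E I J /\ kin E 3 (core I J) = 0%N.
Proof.
move=> tight.
have X3E : S3 (adj E) (fun _ _ _ => 1) = 6 * q%:Z * (n%:Z - 2 * q%:Z) ^+ 2.
  have N2 : n%:Z - 2 * q%:Z = (n - 2 * q)%N by lia.
  have N3 : n%:Z - 3 * q%:Z = (n - 3 * q)%N by lia.
  case: tight => [t3|t4].
    by rewrite X3_kin -kr_kin t3 N2; move: (n - 2 * q)%N => N; lia.
  apply: (K4_tight_K3 es cardV hdegD q3n n4q); rewrite X4_kin -kr_kin N2 N3.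
  by move: t4; move: (n - 2 * q)%N (n - 3 * q)%N => N g; lia.
have [D1E D3E D4E] := K3_tight es cardV hdegD q3n n4q X3E.
have qn : (q <= n)%N by lia.
have D40 a b c d : cl4 (adj E) a b c d -> codeg4 (adj E) a b c d = 0%N.
  by case/D4E.
have D3S a b c d (h : cl4 (adj E) a b c d) := proj1 (D4E a b c d h).
have [I [J [[PI PJ Iq Jq dIJ] tri]]] :=
  tight_parts es cardV D1E qn D40 q3n n4q D3E D3S.
exists I, J; split.
  split=> // v vc; have := D1E v; rewrite codeg1_card.
  have vI : v \notin I by move: vc; rewrite !inE negb_or => /andP[].
  have vJ : v \notin J by move: vc; rewrite !inE negb_or => /andP[].
  have adjI u : u \in I -> adj E v u by move=> uI; rewrite adj_sym (PI u uI).
  have adjJ u : u \in J -> adj E v u by move=> uJ; rewrite adj_sym (PJ u uJ).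
  (* A core vertex is adjacent to all 2q vertices of the two parts, which leaves n - q - 2q
     neighbours in the core. *)
  have -> : [set u | adj E v u] = [set u in core I J | adj E v u] :|: (I :|: J).
    apply/setP => u; rewrite !inE negb_or.
    case uI: (u \in I); first by rewrite adjI ?orbT.
    by case uJ: (u \in J); [rewrite adjJ // orbT | rewrite !orbF].
  have d0 : [set u in core I J | adj E v u] :&: (I :|: J) = set0.
    by apply/setP => u; rewrite !inE; case: (u \in I); case: (u \in J); rewrite ?andbF.
  rewrite cardsU d0 cards0 cardsU Iq Jq (disjoint_setI0 dIJ) cards0 !subn0 => h.
  by rewrite -[LHS](addnK (q + q)) h; lia.
apply/eqP; rewrite cards_eq0 -subset0; apply/subsetP => S; rewrite !inE.
case/andP=> /andP[SX /eqP S3] /cliqueP cS.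
have /card_gt2P[a [b [c [[aS bS cS'] [ab bc ca]]]]] : (2 < #|S|)%N by rewrite S3.
have abc : cl3 (adj E) a b c by rewrite /cl3 !cS // eq_sym.
have inC x : x \in S -> x \in I :|: J = false.
  by move=> xS; apply/negbTE; have := subsetP SX x xS; rewrite inE.
by have := tri a b c abc; rewrite !inC.
Qed.

End MinimumDegree.

Lemma three_parts_deg E I J v : three_parts E I J -> deg E v = (n - q)%N.
Proof.
move=> TP; have [[PI PJ Iq Jq dIJ] reg] := TP.
have inpart K : part (adj E) K -> #|K| = q -> v \in K -> deg E v = (n - q)%N.
  move=> PK Kq vK; have -> : deg E v = #|~: K|.
    by apply: eq_card => u; rewrite !inE (PK v vK).
  by rewrite cardsCs setCK card_ord Kq.
case vI: (v \in I); first exact: inpart vI.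
case vJ: (v \in J); first exact: inpart vJ.
have vc : v \in core I J by rewrite !inE vI vJ.
rewrite /deg (_ : [set u | _] = [set u in core I J | adj E v u] :|: (I :|: J)).
  have d0 : [set u in core I J | adj E v u] :&: (I :|: J) = set0.
    by apply/setP => u; rewrite !inE; case: (u \in I); case: (u \in J); rewrite ?andbF.
  rewrite cardsU d0 cards0 cardsU Iq Jq (disjoint_setI0 dIJ) cards0 !subn0.
  by rewrite (reg v vc); lia.
apply/setP => u; rewrite !inE negb_or.
case uI: (u \in I); first by rewrite adj_sym (PI u uI) vI ?orbT.
by case uJ: (u \in J); [rewrite adj_sym (PJ u uJ) vJ orbT | rewrite !orbF].
Qed.

Lemma three_parts_mindeg E I J : three_parts E I J -> mindeg E (n - q).
Proof.
move=> TP; have n0 : (0 < n)%N by lia.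
apply/andP; split.
  by apply/existsP; exists (Ordinal n0); rewrite (three_parts_deg _ TP).
by apply/forallP => v; rewrite (three_parts_deg _ TP).
Qed.

(** The order is a separate [m], so that the core of one graph can be compared with regular graphs
    on the index type of another core. *)
Lemma exists_induced E (X : {set 'I_n}) m : #|X| = m -> simple E ->
  exists H : sgraph m, [/\ simple H, kr H 3 = kin E 3 X &
    forall k, (forall v, v \in X -> #|[set u in X | adj E v u]| = k) ->
      forall v, deg H v = k].
Proof.
move=> <- sE; pose f (i : 'I_#|X|) := enum_val i.
have finj : injective f by apply: enum_val_inj.
have fX : f @: setT = X.
  apply/setP => x; apply/imsetP/idP => [[i _ ->]|xX]; first exact: enum_valP.
  by exists (enum_rank_in xX x); rewrite // /f enum_rankK_in.
exists (pullback f E); split; first exact: simple_pullback.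
  by rewrite kr_pullback // fX.
move=> k reg v; rewrite deg_pullback // fX -(reg (f v)) ?enum_valP //.
Qed.

Lemma exists_glue (I J : {set 'I_n}) (H : sgraph #|core I J|) :
  [disjoint I & J] -> #|I| = q -> #|J| = q -> simple H ->
  (forall v, deg H v = (n - 3 * q)%N) ->
  exists E, [/\ simple E, three_parts E I J & kin E 3 (core I J) = kr H 3].
Proof.
move=> dIJ Iq Jq sH dH.
pose f (i : 'I_#|core I J|) := enum_val i.
have finj : injective f by apply: enum_val_inj.
have fX : f @: setT = core I J.
  apply/setP => x; apply/imsetP/idP => [[i _ ->]|xX]; first exact: enum_valP.
  by exists (enum_rank_in xX x); rewrite // /f enum_rankK_in.
(* A copy of [H] on the core; elsewhere all pairs except those inside [I] or inside [J]. Diagonal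
   pairs are removed by [graph_of]. *)
pose R x y := if (x \in core I J) && (y \in core I J)
  then [exists i, exists j, [&& f i == x, f j == y & adj H i j]]
  else ~~ ((x \in I) && (y \in I) || (x \in J) && (y \in J)).
have Rs : symmetric R.
  move=> x y; rewrite /R andbC; congr (if _ then _ else _); last first.
    by rewrite [(x \in I) && _]andbC [(x \in J) && _]andbC.
  by apply/existsP/existsP => -[i /existsP[j /and3P[fi fj ij]]]; exists j;
     apply/existsP; exists i; rewrite fi fj adj_sym.
have Rf i j : R (f i) (f j) = adj H i j.
  rewrite /R !enum_valP /=; apply/existsP/idP => [[i' /existsP[j']]|ij].
    by case/and3P => /eqP/finj-> /eqP/finj->.
  by exists i; apply/existsP; exists j; rewrite !eqxx ij.
pose E := graph_of R.
have adjE i j : adj E (f i) (f j) = adj H i j.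
  by rewrite adj_graph_of // Rf (inj_eq finj) /adj; case: (i != j).
have PI : part (adj E) I.
  move=> v vI u; have vJ : v \in J = false by apply: disjointFr vI.
  rewrite adj_graph_of // /R !inE vI vJ /= orbF.
  by case: eqVneq => // <-; rewrite vI.
have PJ : part (adj E) J.
  move=> v vJ u; have vI : v \in I = false by apply: disjointFl vJ.
  rewrite adj_graph_of // /R !inE vI vJ /=.
  by case: eqVneq => // <-; rewrite vJ.
exists E; split; first exact: simple_graph_of.
  split=> // v; rewrite -fX => /imsetP[i _ ->]; rewrite -(dH i).
  rewrite /deg -(card_imset _ finj); apply: eq_card => u; rewrite inE.
  apply/andP/imsetP => [[/imsetP[j _ ->]]|[j]].
    by rewrite adjE => ij; exists j; rewrite ?inE.
  by rewrite inE => ij ->; rewrite adjE imset_f.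
rewrite -[in LHS]fX -(kr_pullback E finj) !kr_kin; apply: eq_kin => i j.
by rewrite adj_pullback.
Qed.

Lemma exists_disjoint_parts :
  exists I J : {set 'I_n}, [/\ [disjoint I & J], #|I| = q & #|J| = q].
Proof.
exists [set i : 'I_n | (0 <= i < q)%N], [set i : 'I_n | (q <= i < 2 * q)%N].
split; try by rewrite card_ord_interval; lia.
by rewrite -setI_eq0; apply/eqP/setP => i; rewrite !inE; lia.
Qed.

Definition core_minimal E I J := forall H : sgraph #|core I J|, simple H ->
  (forall v, deg H v = (n - 3 * q)%N) -> (tri_in E (core I J) <= kr H 3)%N.

(** The parity condition makes the set of regular graphs on the core nonempty; one with the fewest
    triangles is glued to two independent sets. *)
Lemma exists_minimal : ~~ odd ((n - 2 * q) * (n - 3 * q)) ->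
  exists E I J, [/\ simple E, three_parts E I J & core_minimal E I J].
Proof.
move=> ev; have [I [J [dIJ Iq Jq]]] := exists_disjoint_parts.
have cc : #|core I J| = (n - 2 * q)%N.
  rewrite cardsCs setCK card_ord cardsU Iq Jq.
  by rewrite (disjoint_setI0 dIJ) cards0; lia.
pose reg (H : sgraph #|core I J|) :=
  simple H && [forall v, deg H v == (n - 3 * q)%N].
have [H0 sH0 dH0] : exists2 H : sgraph #|core I J|, simple H &
    forall v, deg H v = (n - 3 * q)%N.
  by apply: exists_regular_graph; rewrite cc //; lia.
have regH0 : reg H0 by rewrite /reg sH0; apply/forallP => v; rewrite dH0.
case: (arg_minnP (fun H => kr H 3) regH0) => H /andP[sH /forallP dH] Hmin.
have [|E [sE TP kE]] := exists_glue dIJ Iq Jq sH; first by move=> v; apply/eqP.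
exists E, I, J; split=> // H' sH' dH'; rewrite tri_in_kin kE.
by apply: Hmin; rewrite /reg sH'; apply/forallP => v; rewrite dH'.
Qed.

End ThreePartStructure.

(** * Translation between the family and the three-part shape *)

Section Family.

Variables (n q : nat) (b : rat).
Hypotheses (q3n : (3 * q < n)%N) (n4q : (n <= 4 * q)%N).
Hypothesis bE : b = q%:R / n%:R.
Implicit Types (E : sgraph n).

Let n0 : n%:R != 0 :> rat. Proof. by rewrite pnatr_eq0; lia. Qed.
Let bn : b * n%:R = q%:R. Proof. by rewrite bE divfK. Qed.

(** The bounds on n say 3 < n/q <= 4, so the ceiling is 4. *)
Lemma pbeta_eq3 : pbeta b = 3.
Proof.
rewrite /pbeta bE invf_div (@ceil_def _ _ 4) //.
have q0' : 0 < q%:R :> rat by rewrite ltr0n; lia.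
rewrite ltr_pdivlMr // ler_pdivrMr //.
rewrite -[(4 - 1)%:~R]/(3%:R) -[4%:~R]/(4%:R) -!natrM ltr_nat ler_nat; lia.
Qed.

Lemma pnat_eq3 : Defs.pnat b = 3%N.
Proof. by rewrite /Defs.pnat pbeta_eq3. Qed.

Lemma corner_sizeE : (1 - (3 - 1)%:~R * b) * n%:R = (n - 2 * q)%:R :> rat.
Proof.
rewrite natrB ?natrM; last by lia.
by rewrite mulrBl mul1r -mulrA bn.
Qed.

Lemma corner_degE : (1 - 3%:~R * b) * n%:R = (n - 3 * q)%:R :> rat.
Proof.
rewrite natrB ?natrM; last by lia.
by rewrite mulrBl mul1r -mulrA bn.
Qed.

Lemma natr_eq (x y : nat) : x%:R = y%:R :> rat <-> x = y.
Proof. by split=> [/eqP|->//]; rewrite eqr_nat => /eqP. Qed.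

Lemma family_part_three_parts E (V : 'I_(Defs.pnat b) -> {set 'I_n}) :
  @family_part n b E V -> exists I J, [/\ three_parts q E I J, core_minimal q E I J &
    forall i : 'I_(Defs.pnat b), val i = 0%N -> V i = core I J].
Proof.
rewrite /family_part pbeta_eq3 corner_sizeE corner_degE bn.
move: V; rewrite pnat_eq3 => V [dis [cov [s0 [s1 [joined [indep V0P]]]]]].
pose i0 : 'I_3 := inord 0; pose i1 : 'I_3 := inord 1; pose i2 : 'I_3 := inord 2.
have v0 : val i0 = 0%N by rewrite /= inordK.
have v1 : val i1 = 1%N by rewrite /= inordK.
have v2 : val i2 = 2%N by rewrite /= inordK.
have part_i i : val i <> 0%N -> part (adj E) (V i).
  move=> vi x xi u; case ui: (u \in V i) => /=.
    by apply: negbTE; apply: (indep i vi).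
  have [j uj] := cov u; have ij : i != j.
    by apply/eqP => ij; rewrite ij uj in ui.
  exact: (joined i j ij).
have cE : V i0 = core (V i1) (V i2).
  apply/setP => x; rewrite !inE; apply/idP/idP => [x0|xn].
    have h j : i0 != j -> x \in V j = false by move/dis => d; apply: (disjointFr d).
    by rewrite !h // -val_eqE /= v0 ?v1 ?v2.
  have [[[|[|[|]]] // lt] xj] := cov x.
  - by rewrite (_ : i0 = Ordinal lt) //; apply: val_inj.
  - by move: xn; rewrite (_ : i1 = Ordinal lt) ?xj //; apply: val_inj.
  - by move: xn; rewrite (_ : i2 = Ordinal lt) ?xj ?orbT //; apply: val_inj.
have [reg min] := V0P i0 v0.
exists (V i1), (V i2); split.
- split; first split.
  + by apply: part_i; rewrite v1.
  + by apply: part_i; rewrite v2.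
  + by apply/natr_eq/s1; rewrite v1.
  + by apply/natr_eq/s1; rewrite v2.
  + by apply: dis; rewrite -val_eqE /= v1 v2.
  by rewrite -cE => v vc; apply/natr_eq; rewrite reg.
- rewrite /core_minimal -cE => H sH dH; apply: min => // v.
  by rewrite dH.
- by move=> i vi; rewrite -cE; congr V; apply: val_inj; rewrite vi v0.
Qed.

Lemma three_parts_family_part E I J : three_parts q E I J -> core_minimal q E I J ->
  exists V : 'I_(Defs.pnat b) -> {set 'I_n}, @family_part n b E V /\
    forall i, val i = 0%N -> V i = core I J.
Proof.
move=> TP min; have cc := card_core q3n n4q TP; have [[PI PJ Iq Jq dIJ] reg] := TP.
rewrite /family_part pbeta_eq3 corner_sizeE corner_degE bn pnat_eq3.
pose V (i : 'I_3) := match val i with 0%N => core I J | 1%N => I | _ => J end.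
exists V; split=> //; last by move=> i; rewrite /V => ->.
have Vpart i : val i <> 0%N -> part (adj E) (V i).
  by case: i => [[|[|[|]]] //= lt] _.
have dis i j : i != j -> [disjoint V i & V j].
  have dc (K : {set _}) : K \subset I :|: J -> [disjoint core I J & K].
    by move=> KI; rewrite disjoint_sym disjoints_subset /core setCK.
  have cI := dc _ (subsetUl I J); have cJ := dc _ (subsetUr I J).
  rewrite -val_eqE /V /=; have := ltn_ord j; have := ltn_ord i.
  move: (val i) (val j) => [|[|[|k]]] [|[|[|l]]] //= _ _ _;
    by rewrite ?cI ?cJ ?dIJ // disjoint_sym ?cI ?cJ ?dIJ.
split=> //; split.
  move=> x; case xI: (x \in I); first by exists (inord 1); rewrite /V /= inordK.
  case xJ: (x \in J); first by exists (inord 2); rewrite /V /= inordK.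
  by exists (inord 0); rewrite /V /= inordK // !inE xI xJ.
split; first by move=> i vi; rewrite /V vi cc.
split.
  by case=> [[|[|[|]]] //= lt] _; rewrite /V /= ?Iq ?Jq.
split.
  move=> i j ij x y xi yj.
  have [j0|j0] := eqVneq (val j) 0%N.
    have i0 : val i <> 0%N.
      by move=> i0; case/eqP: ij; apply: val_inj; rewrite i0 j0.
    by rewrite (Vpart i i0 x xi) (disjointFl (dis i j ij) yj).
  rewrite adj_sym (Vpart j _ y yj) ?(disjointFr (dis i j ij) xi) //.
  exact/eqP.
split.
  by move=> i i0 x y xi yi; rewrite (Vpart i i0 x xi) yi.
move=> i vi; rewrite /V vi; split; first by move=> v vc; rewrite reg.
by move=> H sH dH; apply: min => // v; apply/natr_eq; rewrite dH.
Qed.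

End Family.

(** * Evaluation of [g] and comparison with clique counts *)

Section CliqueDensity.

Variables (n q : nat) (b : rat).
Hypotheses (q3n : (3 * q < n)%N) (n4q : (n <= 4 * q)%N).
Hypothesis bE : b = q%:R / n%:R.

Let n0 : n%:R != 0 :> rat. Proof. by rewrite pnatr_eq0; lia. Qed.

Lemma subq_nat (k : nat) : (k * q <= n)%N ->
  (n - k * q)%:R = n%:R - k%:R * q%:R :> rat.
Proof. by move=> h; rewrite natrB ?natrM. Qed.

Lemma g1E : g 1 b * n%:R ^+ 1 = n%:R.
Proof.
rewrite /g (pbeta_eq3 q3n n4q bE).
rewrite (_ : binz _ 1%N = 2%N) // (_ : binz _ _ = 1%N) // (_ : binz _ _ = 0%N) //.
by rewrite bE /=; field.
Qed.

Lemma g2E : 2 * (g 2 b * n%:R ^+ 2) = (n * (n - q))%:R.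
Proof.
rewrite /g (pbeta_eq3 q3n n4q bE).
rewrite (_ : binz _ 2%N = 1%N) // (_ : binz _ _ = 2%N) // (_ : binz _ _ = 1%N) //.
by rewrite natrM -[q in RHS]mul1n subq_nat ?bE /=; [field | lia].
Qed.

Lemma g3E : g 3 b * n%:R ^+ 3 = (q * (n - 2 * q) ^ 2)%:R.
Proof.
rewrite /g (pbeta_eq3 q3n n4q bE).
rewrite (_ : binz _ 3%N = 0%N) // (_ : binz _ _ = 1%N) // (_ : binz _ _ = 2%N) //.
by rewrite natrM natrX subq_nat ?bE /=; [field | lia].
Qed.

Lemma g4E : 2 * (g 4 b * n%:R ^+ 4) = (q ^ 2 * (n - 2 * q) * (n - 3 * q))%:R.
Proof.
rewrite /g (pbeta_eq3 q3n n4q bE).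
rewrite (_ : binz _ 4%N = 0%N) // (_ : binz _ _ = 0%N) // (_ : binz _ _ = 1%N) //.
by rewrite [in RHS]natrM [in RHS]natrM natrX !subq_nat ?bE /=; [field | lia | lia].
Qed.

(** With p - 1 = 2, all three binomial coefficients vanish, so the bound is trivial for such [r]. *)
Lemma g_ge5 r : (4 < r)%N -> g r b = 0.
Proof.
move=> r5; rewrite /g (pbeta_eq3 q3n n4q bE).
have z (x : int) : 2 < x -> binz (3 - 1) x = 0%N.
  by move=> x2; rewrite /binz; case: ifP => // /norP[_]; rewrite -leNgt; lia.
by rewrite !z; [ring | lia | lia | lia].
Qed.

Variable E : sgraph n.

Lemma g_le_kr r : (0 < r)%N -> (forall v, (n - q <= deg E v)%N) ->
  g r b * n%:R ^+ r <= (kr E r)%:R.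
Proof.
move=> r0 hdeg; have [r5|] := ltnP 4 r; first by rewrite g_ge5 // mul0r.
case: r r0 => [|[|[|[|[|]]]]] // _ _.
- by rewrite g1E kr_kin kin1 cardsT card_ord.
- rewrite -(ler_pM2l (x := 2)) // g2E -natrM ler_nat.
  exact: kr2_lower.
- rewrite g3E ler_nat; exact: kr3_lower.
- rewrite -(ler_pM2l (x := 2)) // g4E -natrM ler_nat.
  exact: kr4_lower.
Qed.

Lemma kr_eq_g r : r = 3%N \/ r = 4%N ->
  ((kr E r)%:R = g r b * n%:R ^+ r <->
   (if r == 3 then kr E 3 = q * (n - 2 * q) ^ 2
    else 2 * kr E 4 = q ^ 2 * (n - 2 * q) * (n - 3 * q))%N).
Proof.
case=> -> /=; first by rewrite g3E natr_eq.
rewrite -natr_eq -g4E natrM; split=> [->//|].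
by apply: mulfI.
Qed.

Lemma kr_eq_g_three_parts r : r = 3%N \/ r = 4%N ->
  (forall v, (n - q <= deg E v)%N) -> (kr E r)%:R = g r b * n%:R ^+ r ->
  exists I J, three_parts q E I J /\ kin E 3 (core I J) = 0%N.
Proof.
move=> r34 hdeg /(kr_eq_g r34) H; apply: kr_tight => //.
by case: r34 H => ->; [left | right].
Qed.

Lemma three_parts_kr_eq_g r I J : r = 3%N \/ r = 4%N ->
  three_parts q E I J -> kin E 3 (core I J) = 0%N ->
  (kr E r)%:R = g r b * n%:R ^+ r.
Proof.
move=> r34 TP /(three_parts_kin q3n n4q TP)[k3 k4].
by apply/(kr_eq_g r34); case: r34 => ->.
Qed.

End CliqueDensity.

(** * Feasibility and the final assembly *)

Lemma triangle_free_core_minimal n q (E : sgraph n) I J :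
  kin E 3 (core I J) = 0%N -> core_minimal q E I J.
Proof. by move=> k0 H _ _; rewrite tri_in_kin k0. Qed.

(** The product of order and degree is the degree sum, which is even. *)
Lemma three_parts_parity n q (E : sgraph n) I J : (3 * q < n)%N -> (n <= 4 * q)%N ->
  three_parts q E I J -> ~~ (odd n && odd (n - q)).
Proof.
move=> q3n n4q TP; rewrite -oddM.
have := handshake E; rewrite (eq_bigr (fun=> n - q)%N).
  by rewrite sum_nat_const card_ord => ->; rewrite mul2n odd_double.
by move=> v _; apply: three_parts_deg TP.
Qed.

(* Comparing with the triangle-free core of one member shows that every member of
   the family has a triangle-free V_0. *)
Lemma three_parts_feasible n q b (E : sgraph n) I J :
  (3 * q < n)%N -> (n <= 4 * q)%N -> b = q%:R / n%:R -> simple E ->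
  three_parts q E I J -> kin E 3 (core I J) = 0%N -> feasible n b.
Proof.
move=> q3n n4q bE sE TP k0; have n0 : n%:R != 0 :> rat by rewrite pnatr_eq0; lia.
split.
  split; first by lia.
  exists (n - q)%N; split; first by lia.
  split; last exact: three_parts_parity TP.
  by rewrite bE mulrBl mul1r divfK // natrB //; lia.
move=> E' V sE' FP i i0.
have [I' [J' [TP' min ->]]] := family_part_three_parts q3n n4q bE FP; last by [].
have cc' := card_core q3n n4q TP'; have cc := card_core q3n n4q TP.
have [H [sH k3 reg]] := exists_induced (etrans cc (esym cc')) sE.
apply/eqP; rewrite -leqn0 -k0 -k3; apply: min => //.
by apply: reg; case: TP.
Qed.

Theorem mainTheorem3 (n d : nat) :
  (0 < n)%N -> (0 < d)%N -> (2 * n < 3 * d)%N -> (4 * d <= 3 * n)%N ->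
  let b : rat := 1 - d%:R / n%:R in
  (forall r : nat, (0 < r)%N -> g r b * n%:R ^+ r <= (krmin n d r)%:R) /\
  (forall r : nat, r = 3%N \/ r = 4%N ->
     ((krmin n d r)%:R = g r b * n%:R ^+ r <-> feasible n b) /\
     (feasible n b ->
        forall E : sgraph n, simple E -> mindeg E d ->
          ((kr E r)%:R = g r b * n%:R ^+ r <-> @in_family n b E))).
Proof.
move=> n_gt0 d_gt0 dlo dhi b; pose q := (n - d)%N.
have [q3n n4q] : (3 * q < n)%N /\ (n <= 4 * q)%N by rewrite /q; lia.
have dq : (n - q)%N = d by rewrite /q; lia.
have n0 : n%:R != 0 :> rat by rewrite pnatr_eq0; lia.
have bE : b = q%:R / n%:R.
  by rewrite /b natrB ?mulrBl ?divff //; lia.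
have lower r : (0 < r)%N -> g r b * n%:R ^+ r <= (krmin n d r)%:R.
  move=> r0; have [|E _ [dE <-]] := @krmin_attained n d r; first by lia.
  by apply: (g_le_kr q3n n4q bE) => // v; rewrite dq.
split=> // r r34; have r0 : (0 < r)%N by case: r34 => ->.
(* Feasibility speaks of members of the family; a three-part graph with a minimal core is one of
   them. *)
have free (E : sgraph n) I J : feasible n b -> simple E -> three_parts q E I J ->
    core_minimal q E I J -> kin E 3 (core I J) = 0%N.
  move=> [_ F] sE TP min.
  have [V [FP VE]] := three_parts_family_part q3n n4q bE TP min.
  have p0 : (0 < Defs.pnat b)%N by rewrite (pnat_eq3 q3n n4q bE).
  by have := F E V sE FP (Ordinal p0) erefl; rewrite VE.
split; first split.
- move=> eq_g; have [|E sE [dE kE]] := @krmin_attained n d r; first by lia.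
  rewrite -kE in eq_g.
  have [|I [J [TP k0]]] := kr_eq_g_three_parts q3n n4q bE r34 _ eq_g.
    by move=> v; rewrite dq.
  exact: three_parts_feasible TP k0.
- move=> Fe; have [_ [d' [_ [d'E odd_nd']]]] := proj1 Fe.
  have d'd : d' = d.
    by apply/natr_eq; rewrite d'E /b subKr divfK.
  have [|E [I [J [sE TP min]]]] := @exists_minimal n q q3n n4q.
    (* Modulo 2 the core has order n and degree d, so the parity condition on the family is exactly
       what the regular core requires. *)
    have o2 : odd (n - 2 * q) = odd n by lia.
    have o3 : odd (n - 3 * q) = odd d by lia.
    by rewrite oddM o2 o3 -d'd.
  apply/eqP; rewrite eq_le lower // andbT.
  rewrite -(three_parts_kr_eq_g q3n n4q bE r34 TP) ?(free E) // ler_nat.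
  by apply: krmin_le => //; rewrite -dq; apply: three_parts_mindeg TP.
move=> Fe E sE dE; split=> [eq_g|[_ [_ [V FP]]]].
  have [|I [J [TP k0]]] := kr_eq_g_three_parts q3n n4q bE r34 _ eq_g.
    by move=> v; rewrite dq; case/andP: dE => _ /forallP.
  split; first by case: Fe.
  have [V [FP _]] := three_parts_family_part q3n n4q bE TP
                       (triangle_free_core_minimal k0).
  by split=> //; exists V.
have [I [J [TP min _]]] := family_part_three_parts q3n n4q bE FP.
by apply: (three_parts_kr_eq_g q3n n4q bE r34 TP); apply: free TP min.
Qed.
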